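(* Let $n\ge 1$ and $w\in S_n$. Let $\theta_w$ denote the number of supports of the Schubert polynomial $\mathfrak{S}_w(x)$, i.e. the number of exponent vectors $\alpha\in\mathbb{Z}_{\ge0}^n$ such that the monomial $x^\alpha$ has nonzero coefficient in $\mathfrak{S}_w(x)$. Then \begin{align*} \theta_w\ \ge\ & 1+p_{132}(w)+p_{1432}(w)+p_{13254}(w)+3p_{14253}(w)+p_{14352}(w)+4p_{15243}(w)+p_{15324}(w)\\ &+2p_{15342}(w)+p_{15432}(w)+p_{24153}(w)+2p_{25143}(w)+p_{35142}(w). \end{align*}
   Context: Schubert polynomials are defined recursively: for the longest permutation $w_0=n\cdots21\in S_n$, $\mathfrak{S}_{w_0}(x)=x_1^{n-1}x_2^{n-2}\cdots x_{n-1}$; for $w\ne w_0$, choose $1\le i<n$ with $w(i)<w(i+1)$ and set $\mathfrak{S}_w(x)=\partial_i\mathfrak{S}_{ws_i}(x)$, where $ws_i$ is $w$ with the values $w(i),w(i+1)$ swapped and $\partial_i f=\frac{f-f|_{x_i\leftrightarrow x_{i+1}}}{x_i-x_{i+1}}$. For $u\in S_m$ with $m\le n$, a $u$ pattern in $w$ is a subsequence $w(i_1)\cdots w(i_m)$ with $i_1<\cdots<i_m$ having the same relative order as $u(1)\cdots u(m)$; $p_u(w)$ is the number of $u$ patterns in $w$. *)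

(* Defs.v *)
From HB Require Import structures.
From mathcomp Require Import all_boot all_order all_fingroup all_algebra.
From mathcomp Require Import ring zify.
From mathcomp.multinomials Require Import mpoly.

Set Implicit Arguments.
Unset Strict Implicit.
Unset Printing Implicit Defensive.

Import Order.TTheory GRing.Theory Num.Theory.

Local Open Scope ring_scope.

Lemma comm_generic (R : idomainType) (s t : {rmorphism R -> R})
    (x y f g1 h1 g2 h2 : R) : x != 0 -> y != 0 -> s y = y -> t x = x ->
  s (t f) = t (s f) ->
  g1 * y = f - t f -> h1 * x = g1 - s g1 ->
  g2 * x = f - s f -> h2 * y = g2 - t g2 -> h1 = h2.
Proof.
move=> x0 y0 sy tx st e1 e2 e3 e4; apply: (mulIf x0); apply: (mulIf y0).
rewrite e2 mulrBl e1 -[X in s g1 * X]sy -rmorphM e1 rmorphB.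
rewrite mulrAC e4 mulrBl e3 -[X in t g2 * X]tx -rmorphM e3 rmorphB st.
by ring.
Qed.

Lemma braid_expand (R : comNzRingType) (s t : {rmorphism R -> R})
    (a b c f g1 g2 g3 : R) :
  s a = b -> s b = a -> s c = c -> t a = a -> t b = c -> t c = b ->
  involutive s ->
  g1 * (a - b) = f - s f -> g2 * (b - c) = g1 - t g1 -> g3 * (a - b) = g2 - s g2 ->
  g3 * ((a - b) * (b - c) * (a - c)) * (a - b)
    = (f - s f - t f + t (s f) + s (t f) - s (t (s f))) * (a - b).
Proof.
move=> sa sb sc ta tb tc sK e1 e2 e3.
have e1t : t g1 * (a - c) = t f - t (s f).
  by rewrite -rmorphB -e1 rmorphM rmorphB ta tb.
have e2' : g2 * ((b - c) * (a - b) * (a - c))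
    = (a - c) * (f - s f) - (a - b) * (t f - t (s f)).
  by rewrite -e1 -e1t !mulrA e2; ring.
have e2s : s g2 * ((a - c) * (b - a) * (b - c))
    = (b - c) * (s f - f) - (b - a) * (s (t f) - s (t (s f))).
  have := congr1 s e2'.
  by rewrite !(rmorphM, rmorphB) sa sb sc sK.
transitivity (g3 * (a - b) * ((b - c) * (a - b) * (a - c))); first by ring.
rewrite e3 mulrBl e2'.
have -> : s g2 * ((b - c) * (a - b) * (a - c))
  = - (s g2 * ((a - c) * (b - a) * (b - c))) by ring.
by rewrite e2s; ring.
Qed.

Lemma braid_generic (R : idomainType) (s t : {rmorphism R -> R})
    (a b c f g1 g2 g3 h1 h2 h3 : R) :
  a - b != 0 -> b - c != 0 -> a - c != 0 ->
  s a = b -> s b = a -> s c = c -> t a = a -> t b = c -> t c = b ->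
  involutive s -> involutive t -> s (t (s f)) = t (s (t f)) ->
  g1 * (a - b) = f - s f -> g2 * (b - c) = g1 - t g1 -> g3 * (a - b) = g2 - s g2 ->
  h1 * (b - c) = f - t f -> h2 * (a - b) = h1 - s h1 -> h3 * (b - c) = h2 - t h2 ->
  g3 = h3.
Proof.
move=> ab0 bc0 ac0 sa sb sc ta tb tc sK tK sts e1 e2 e3 e4 e5 e6.
have cb (p : R) : - p * (c - b) = p * (b - c) by rewrite mulNr -mulrN opprB.
have E1 := mulIf ab0 (braid_expand sa sb sc ta tb tc sK e1 e2 e3).
have e4' : - h1 * (c - b) = f - t f by rewrite cb.
have e5' : h2 * (b - a) = - h1 - s (- h1).
  by rewrite -opprB mulrN e5 rmorphN opprB opprK addrC.
have e6' : - h3 * (c - b) = h2 - t h2 by rewrite cb.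
have cb0 : c - b != 0 by rewrite -opprB oppr_eq0.
have E2 := mulIf cb0 (braid_expand tc tb ta sc sb sa tK e4' e5' e6').
apply: (mulIf (mulf_neq0 (mulf_neq0 ab0 bc0) ac0)).
rewrite E1 sts.
have -> : h3 * ((a - b) * (b - c) * (a - c))
  = - h3 * ((c - b) * (b - a) * (c - a)) by ring.
by rewrite E2; ring.
Qed.

Section DividedDifference.
Variable n : nat.
Implicit Types (i j k : 'I_n) (f g : {mpoly int[n]}).

Lemma msym_tpermX i j k :
  msym (tperm i j) 'X_k = 'X_(tperm i j k) :> {mpoly int[n]}.
Proof.
rewrite msymX; congr 'X_[_]; apply/mnmP => l; rewrite mnmE !mnmE tpermV.
by congr (nat_of_bool _); rewrite -(inj_eq (@perm_inj _ (tperm i j))) tpermK.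
Qed.

Lemma divdiff_subproof i j f :
  exists g, g * ('X_i - 'X_j) == f - msym (tperm i j) f.
Proof.
pose P f := exists g, g * ('X_i - 'X_j) = f - msym (tperm i j) f.
have PM f1 f2 : P f1 -> P f2 -> P (f1 * f2).
  case=> [g1 e1] [g2 e2]; exists (g1 * f2 + msym (tperm i j) f1 * g2).
  rewrite msymM mulrDl (mulrAC g1) e1 -(mulrA (msym _ f1)) e2.
  by rewrite mulrBl mulrBr addrA subrK.
have P1 : P 1 by exists 0; rewrite msym1 mul0r subrr.
have PX k : P 'X_k.
  rewrite /P msym_tpermX; case: tpermP => [->|->|_ _].
  - by exists 1; rewrite mul1r.
  - by exists (-1); rewrite mulN1r opprB.
  - by exists 0; rewrite subrr mul0r.
suff [g e] : P f by exists g; rewrite e.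
elim/mpolyind: f => [|c m p _ _ [g e]].
  by exists 0; rewrite msym0 mul0r subrr.
have [h e'] : P 'X_[m].
  rewrite mpolyXE_id; apply: (big_ind P) => // k _.
  by elim: (m k) => [|d IHd]; rewrite ?expr0 // exprS; apply: PM.
exists (c *: h + g).
rewrite mulrDl -scalerAl e' e msymD msymZ scalerBr opprD.
by rewrite !addrA; congr (_ - _); rewrite addrAC.
Qed.

(* The divided difference (f - f|_{x_i <-> x_j}) / (x_i - x_j): for i != j the
   polynomial g below exists and is unique (divdiff_uniq). *)
Definition divdiff i j f : {mpoly int[n]} := xchoose (divdiff_subproof i j f).

Lemma divdiffE i j f :
  divdiff i j f * ('X_i - 'X_j) = f - msym (tperm i j) f.
Proof. exact/eqP/(xchooseP (divdiff_subproof i j f)). Qed.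

Lemma subX_neq0 i j : i != j -> 'X_i - 'X_j != 0 :> {mpoly int[n]}.
Proof.
move=> nij; rewrite subr_eq0; apply/eqP => /(congr1 (mcoeff U_(i)%MM)).
rewrite !mcoeffX eqxx; case: eqP => [/mnmP e _|//].
by move: (e i); rewrite !mnmE eqxx eq_sym (negPf nij).
Qed.

Lemma divdiff_uniq i j f g : i != j ->
  g * ('X_i - 'X_j) = f - msym (tperm i j) f -> g = divdiff i j f.
Proof. by move=> nij; rewrite -divdiffE => /(mulIf (subX_neq0 nij)). Qed.

Lemma divdiff_comm i j k l f : i != j -> k != l ->
    [&& i != k, i != l, j != k & j != l] ->
  divdiff i j (divdiff k l f) = divdiff k l (divdiff i j f).
Proof.
move=> nij nkl /and4P[nik nil njk njl].
have tC : commute (tperm i j) (tperm k l).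
  by apply/commgP/conjg_fixP; rewrite tpermJ !tpermD // eq_sym.
have fixX (a b c d : 'I_n) : [&& a != c, a != d, b != c & b != d] ->
    msym (tperm a b) ('X_c - 'X_d) = 'X_c - 'X_d :> {mpoly int[n]}.
  by case/and4P=> ? ? ? ?; rewrite msymB !msym_tpermX !tpermD.
have s1 : msym (tperm i j) ('X_k - 'X_l) = 'X_k - 'X_l :> {mpoly int[n]}.
  by apply: fixX; rewrite nik nil njk njl.
have s2 : msym (tperm k l) ('X_i - 'X_j) = 'X_i - 'X_j :> {mpoly int[n]}.
  by apply: fixX; rewrite !(eq_sym k) !(eq_sym l) nik nil njk njl.
have C : msym (tperm k l) (msym (tperm i j) f) = msym (tperm i j) (msym (tperm k l) f).
  by rewrite -[LHS]msymMm -[RHS]msymMm tC.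
exact: (comm_generic (subX_neq0 nij) (subX_neq0 nkl) s1 s2 (esym C)
  (divdiffE k l f) (divdiffE i j _) (divdiffE i j f) (divdiffE k l _)).
Qed.

Lemma divdiff_braid i j k f : i != j -> j != k -> i != k ->
  divdiff i j (divdiff j k (divdiff i j f))
    = divdiff j k (divdiff i j (divdiff j k f)).
Proof.
move=> nij njk nik.
have tK (x y : 'I_n) : involutive (@msym n int (tperm x y)).
  by move=> p; rewrite -msymMm tperm2 msym1m.
have sX (x y z v : 'I_n) : tperm x y z = v ->
    msym (tperm x y) 'X_z = 'X_v :> {mpoly int[n]}.
  by rewrite msym_tpermX => ->.
have sts : msym (tperm i j) (msym (tperm j k) (msym (tperm i j) f))
    = msym (tperm j k) (msym (tperm i j) (msym (tperm j k) f)).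
  have E (s t : 'S_n) : msym s (msym t (msym s f)) = msym (s * (t * s)) f.
    by rewrite msymMm msymMm.
  rewrite E [RHS]E; congr (msym _ f).
  have -> : (tperm i j * (tperm j k * tperm i j) = tperm j k ^ tperm i j)%g.
    by rewrite conjgE tpermV.
  have -> : (tperm j k * (tperm i j * tperm j k) = tperm i j ^ tperm j k)%g.
    by rewrite conjgE tpermV.
  by rewrite !tpermJ tpermL tpermR !tpermD // eq_sym.
have tDi : tperm j k i = i by rewrite tpermD // eq_sym.
have tDk : tperm i j k = k by rewrite tpermD.
exact: (braid_generic (subX_neq0 nij) (subX_neq0 njk) (subX_neq0 nik)
  (sX i j i j (tpermL _ _)) (sX i j j i (tpermR _ _)) (sX i j k k tDk)
  (sX j k i i tDi) (sX j k j k (tpermL _ _)) (sX j k k j (tpermR _ _))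
  (tK i j) (tK j k) sts (divdiffE i j f) (divdiffE j k _) (divdiffE i j _)
  (divdiffE j k f) (divdiffE i j _) (divdiffE j k _)).
Qed.

End DividedDifference.

(* Positions and values of permutations are 0-based: they live in 'I_n = {0, ..., n-1}. *)
Section Schubert.
Variable n : nat.
Implicit Types (w v : 'S_n) (i j k l : 'I_n).

Definition w0 : 'S_n := perm (@rev_ord_inj n).

(* j is the position next to i, and w(i) < w(j) *)
Definition ascent w i j : bool := (j == i.+1 :> nat) && (w i < w j)%N.

(* w s_i; in MathComp (s * w) x = w (s x) *)
Definition swap_pos w i j : 'S_n := (tperm i j * w)%g.

(* x_1^(n-1) x_2^(n-2) ... x_(n-1) *)
Definition staircase_monomial : {mpoly int[n]} :=
  \prod_(i < n) 'X_i ^+ (n.-1 - i).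

Definition noninversions w : {set 'I_n * 'I_n} :=
  [set p : 'I_n * 'I_n | (p.1 < p.2)%N && (w p.1 < w p.2)%N].

(* Each step removes at least one noninversion (noninversions_swap_pos) and only
   w0 has no ascent (no_ascent_w0), so with fuel #|noninversions w| the value 0 is
   never used. The result does not depend on the ascent picked: schubert_w0 and
   schubert_ascent are the usual recursion. *)
Fixpoint schubert_rec (fuel : nat) (w : 'S_n) : {mpoly int[n]} :=
  if [pick p : 'I_n * 'I_n | ascent w p.1 p.2] is Some p then
    if fuel is fuel'.+1 then
      divdiff p.1 p.2 (schubert_rec fuel' (swap_pos w p.1 p.2))
    else 0
  else staircase_monomial.

Definition schubert w : {mpoly int[n]} :=
  schubert_rec #|noninversions w| w.

Lemma noninversions_swap_pos w i j : ascent w i j ->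
  (#|noninversions (swap_pos w i j)| < #|noninversions w|)%N.
Proof.
case/andP=> /eqP ej lt_w.
have lt_ij : (i < j)%N by rewrite ej.
pose h (p : 'I_n * 'I_n) := (tperm i j p.1, tperm i j p.2).
have h_inj : injective h.
  by case=> [a b] [c d] [/perm_inj-> /perm_inj->].
rewrite -(card_imset _ h_inj); apply/proper_card/properP; split.
  apply/subsetP => _ /imsetP[[a b] + ->]; rewrite !inE /= !permM.
  case/andP=> lt_ab lt_wab; rewrite lt_wab andbT.
  have : (a, b) != (i, j).
    apply: contraTneq lt_wab => -[-> ->].
    by rewrite tpermL tpermR -leqNgt ltnW.
  rewrite xpair_eqE; move: lt_ab {lt_wab}.
  case: tpermP => [->|->|/eqP + /eqP +]; case: tpermP => [->|->|/eqP + /eqP +];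
    rewrite -?val_eqE /=; lia.
exists (i, j); first by rewrite inE /= lt_ij.
apply/imsetP => -[[a b]]; rewrite inE /= => /andP[lt_ab _] [ei ej'].
move: lt_ab; rewrite -(tpermK i j a) -(tpermK i j b) -ei -ej' tpermL tpermR.
by rewrite ltnNge ltnW.
Qed.

Lemma no_ascent_w0 w : ~~ [exists p : 'I_n * 'I_n, ascent w p.1 p.2] -> w = w0.
Proof.
move/existsPn => noasc.
have dec (i j : 'I_n) : (i < j)%N -> (w j < w i)%N.
  move=> lt_ij; have [d] := ubnP (j - i); elim: d j lt_ij => // d IHd j lt_ij ltd.
  have pj : (j.-1 < n)%N by apply: leq_ltn_trans (ltn_ord j); rewrite leq_pred.
  pose k := Ordinal pj.
  have lt_jk : (w j < w k)%N.
    have := noasc (k, j); rewrite /ascent /= prednK ?eqxx /=; last by lia.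
    rewrite -leqNgt leq_eqVlt => /orP[/eqP/val_inj/perm_inj e|//].
    by have := congr1 val e; rewrite /=; lia.
  have [lt_ik|] := ltnP i k; last first.
    move=> le_ki; have -> : i = k by apply/val_inj => /=; rewrite /= in le_ki; lia.
    by [].
  by apply: ltn_trans lt_jk (IHd k lt_ik _); rewrite /=; rewrite /= in lt_ik; lia.
have le_w m (i : 'I_n) : i = m :> nat -> (w i <= n.-1 - m)%N.
  elim: m i => [|m IHm] i ei; first by have := ltn_ord (w i); lia.
  have pi : (m < n)%N by rewrite ltnW // -ei.
  have := IHm (Ordinal pi) erefl; have := dec (Ordinal pi) i.
  by rewrite ei /= => /(_ (ltnSn m)); lia.
have ge_w m (i : 'I_n) : (n.-1 - i = m)%N -> (m <= w i)%N.
  elim: m i => [//|m IHm] i ei.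
  have pi : (i.+1 < n)%N by lia.
  have := IHm (Ordinal pi); have := dec i (Ordinal pi).
  by rewrite /= => /(_ (ltnSn _)) ? /(_ ltac:(lia)); lia.
apply/permP => i; rewrite permE; apply/val_inj => /=.
by have := le_w i i erefl; have := ge_w _ i erefl; have := ltn_ord i; lia.
Qed.

Lemma not_ascent_w0 i j : ascent w0 i j = false.
Proof.
rewrite /ascent !permE /=; case: eqP => //= ej.
by apply/negbTE; have := ltn_ord j; lia.
Qed.

Lemma schubert_w0 : schubert w0 = staircase_monomial.
Proof.
rewrite /schubert; case: #|_| => [|m] /=;
  by case: pickP => // p; rewrite not_ascent_w0.
Qed.

Lemma schubert_rec_fuel (k1 k2 : nat) w :
  (#|noninversions w| <= k1)%N -> (#|noninversions w| <= k2)%N ->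
  schubert_rec k1 w = schubert_rec k2 w.
Proof.
have ninv_gt0 v p : ascent v p.1 p.2 -> (0 < #|noninversions v|)%N.
  by move/noninversions_swap_pos; apply: leq_ltn_trans.
elim: k1 k2 w => [|k1 IHk] k2 w.
  rewrite leqn0 => /eqP ew _.
  by case: k2 => [|k2] /=; case: pickP => // p /ninv_gt0; rewrite ew.
case: k2 => [|k2] le1 le2 /=; case: pickP => [p asc|_].
- by have := ninv_gt0 _ _ asc; rewrite lt0n -leqn0 le2.
- reflexivity.
- have lt := noninversions_swap_pos asc; congr (divdiff _ _ _).
  by apply: IHk; rewrite -ltnS; apply: leq_trans lt _.
- reflexivity.
Qed.

Lemma schubert_ascent w i j : ascent w i j ->
  schubert w = divdiff i j (schubert (swap_pos w i j)).
Proof.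
have [N] := ubnP #|noninversions w|; elim: N w i j => // N IHN w i j ltN.
have pickE v k l : ascent v k l -> exists k' l', ascent v k' l' /\
    schubert v = divdiff k' l' (schubert (swap_pos v k' l')).
  move=> asc; rewrite {1}/schubert.
  case e: #|noninversions v| => [|m].
    by have := noninversions_swap_pos asc; rewrite e.
  rewrite /=; case: pickP => [p ascp|/(_ (k, l))]; last by rewrite asc.
  exists p.1, p.2; split; first exact: ascp.
  congr (divdiff _ _ _); apply: schubert_rec_fuel; last exact: leqnn.
  by have := noninversions_swap_pos ascp; rewrite e.
move=> asc; have [k [l [asc' ->]]] := pickE w i j asc.
have IH v x y : (#|noninversions v| < #|noninversions w|)%N -> ascent v x y ->
    schubert v = divdiff x y (schubert (swap_pos v x y)).
  by move=> lt; apply: IHN; apply: leq_trans lt _; rewrite -ltnS.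
have sym i1 j1 i2 j2 : ascent w i1 j1 -> ascent w i2 j2 -> (i1 < i2)%N ->
    divdiff i1 j1 (schubert (swap_pos w i1 j1))
      = divdiff i2 j2 (schubert (swap_pos w i2 j2)).
  move=> a1 a2 lt12.
  have lt1 := noninversions_swap_pos a1; have lt2 := noninversions_swap_pos a2.
  have [/eqP ej1 w1] := andP a1; have [/eqP ej2 w2] := andP a2.
  have n1 : i1 != j1 by rewrite -val_eqE /=; lia.
  have n2 : i2 != j2 by rewrite -val_eqE /=; lia.
  have n12 : i1 != i2 by rewrite -val_eqE /=; lia.
  have m12 : i1 != j2 by rewrite -val_eqE /=; lia.
  have k12 : j1 != j2 by rewrite -val_eqE /=; lia.
  have [e|ne] := eqVneq j1 i2.
    subst i2.
    have tjk_i : tperm j1 j2 i1 = i1 by rewrite tpermD // eq_sym.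
    have tij_k : tperm i1 j1 j2 = j2 by rewrite tpermD.
    have tE := (permM, tjk_i, tij_k, tpermL, tpermR).
    have w3 := ltn_trans w1 w2.
    have b1 : ascent (swap_pos w i1 j1) j1 j2.
      by rewrite /ascent ej2 eqxx !tE.
    have b2 : ascent (swap_pos w j1 j2) i1 j1.
      by rewrite /ascent ej1 eqxx !tE.
    have c1 : ascent (swap_pos (swap_pos w i1 j1) j1 j2) i1 j1.
      by rewrite /ascent ej1 eqxx !tE.
    have c2 : ascent (swap_pos (swap_pos w j1 j2) i1 j1) j1 j2.
      by rewrite /ascent ej2 eqxx !tE.
    rewrite (IH _ _ _ lt1 b1) (IH _ _ _ lt2 b2).
    rewrite (IH _ _ _ (ltn_trans (noninversions_swap_pos b1) lt1) c1).
    rewrite (IH _ _ _ (ltn_trans (noninversions_swap_pos b2) lt2) c2).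
    rewrite (divdiff_braid _ n1 n2 m12).
    congr (divdiff _ _ (divdiff _ _ (divdiff _ _ (schubert _)))).
    rewrite /swap_pos !mulgA; congr (_ * _)%g.
    have -> : (tperm i1 j1 * tperm j1 j2 * tperm i1 j1 = tperm j1 j2 ^ tperm i1 j1)%g.
      by rewrite conjgE tpermV mulgA.
    have -> : (tperm j1 j2 * tperm i1 j1 * tperm j1 j2 = tperm i1 j1 ^ tperm j1 j2)%g.
      by rewrite conjgE tpermV mulgA.
    by rewrite !tpermJ tpermL tpermR !tpermD // eq_sym.
  have b1 : ascent (swap_pos w i1 j1) i2 j2.
    by rewrite /ascent ej2 eqxx !permM !tpermD.
  have b2 : ascent (swap_pos w i2 j2) i1 j1.
    by rewrite /ascent ej1 eqxx !permM !tpermD // eq_sym.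
  have nn : [&& i1 != i2, i1 != j2, j1 != i2 & j1 != j2] by rewrite n12 m12 ne.
  rewrite (IH _ _ _ lt1 b1) (IH _ _ _ lt2 b2) (divdiff_comm _ n1 n2 nn).
  congr (divdiff _ _ (divdiff _ _ (schubert _))).
  rewrite /swap_pos !mulgA; congr (_ * _)%g.
  by apply/esym/commgP/conjg_fixP; rewrite tpermJ !tpermD // eq_sym.
have [lt|lt|e] := ltngtP i k; [exact/esym/sym|exact: sym|].
have ei : i = k by apply: val_inj.
have ej : j = l.
  have [/eqP ej _] := andP asc; have [/eqP el _] := andP asc'.
  by apply: val_inj; rewrite /= ej el ei.
by rewrite ei ej.
Qed.

(* The number of exponent vectors of nonzero coefficient: msupp lists them
   without repetition. *)
Definition theta w : nat := size (msupp (schubert w)).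

(* p_u(w), for u in one-line notation: the number of index sequences
   c(0) < c(1) < ... < c(m-1) along which w is ordered like u. *)
Definition pattern_count (u : seq nat) w : nat :=
  #|[set c : {ffun 'I_(size u) -> 'I_n} |
      [forall a : 'I_(size u), forall b : 'I_(size u), (a < b)%N ==> (c a < c b)%N] &&
      [forall a : 'I_(size u), forall b : 'I_(size u),
         (w (c a) < w (c b))%N == (nth 0%N u a < nth 0%N u b)%N]]|.

End Schubert.

(* Main.v *)
(** Let D(w) be the Rothe diagram of w. A diagram C obtained by pushing boxes of
    D(w) upwards inside their columns has weight in the support of S_w: if k is the
    first position where w differs from w0, the co-transition formula
    x_k S_w = sum_j S_(w t_kj), over the covers w t_kj of w with k < j, shows
    inductively that all coefficients are nonnegative, and some C with the same
    weight becomes, once a box is added in row k, such a diagram for one of the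
    w t_kj.
    It then suffices to push boxes along rows p < i < k < l in three ways: s boxes
    from i to p; s boxes from i and s' boxes from k to p; s boxes from i to p and
    t boxes from l to k. The resulting weights are pairwise distinct, and counting
    the admissible parameters by occurrences of patterns gives the bound. *)

Require Import Defs.
From mathcomp Require Import all_boot all_order all_fingroup all_algebra.
From mathcomp Require Import ring zify.
From mathcomp.multinomials Require Import mpoly.

Set Implicit Arguments.
Unset Strict Implicit.
Unset Printing Implicit Defensive.

Import Order.TTheory GRing.Theory Num.Theory.

Local Open Scope ring_scope.

(** * Divided differences *)

Lemma divdiff0 n (i j : 'I_n) : i != j -> divdiff i j 0 = 0.
Proof. by move=> nij; apply/esym/divdiff_uniq; rewrite // msym0 mul0r subrr. Qed.

Lemma divdiffD n (i j : 'I_n) (f g : {mpoly int[n]}) : i != j ->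
  divdiff i j (f + g) = divdiff i j f + divdiff i j g.
Proof.
move=> nij; apply/esym/divdiff_uniq => //.
by rewrite mulrDl !divdiffE msymD opprD addrACA.
Qed.

Lemma divdiff_sum n (i j : 'I_n) (I : finType) (F : I -> {mpoly int[n]}) :
  i != j -> divdiff i j (\sum_x F x) = \sum_x divdiff i j (F x).
Proof.
move=> nij; apply: (big_morph (divdiff i j)) => [f g|]; last exact: divdiff0.
exact: divdiffD.
Qed.

Lemma divdiff_sym n (i j : 'I_n) (f : {mpoly int[n]}) : i != j ->
  msym (tperm i j) f = f -> divdiff i j f = 0.
Proof. by move=> nij sf; apply/esym/divdiff_uniq; rewrite // sf subrr mul0r. Qed.

Lemma msym_divdiff n (i j : 'I_n) (f : {mpoly int[n]}) : i != j ->
  msym (tperm i j) (divdiff i j f) = divdiff i j f.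
Proof.
move=> nij; apply: divdiff_uniq => //.
have sX : msym (tperm i j) ('X_i - 'X_j) = - ('X_i - 'X_j) :> {mpoly int[n]}.
  by rewrite msymB !msym_tpermX tpermL tpermR opprB.
apply: oppr_inj; rewrite -mulrN -sX -msymM divdiffE msymB -msymMm tperm2.
by rewrite msym1m opprB.
Qed.

Lemma divdiffXl n (k i j : 'I_n) (f : {mpoly int[n]}) :
  i != j -> k != i -> k != j -> divdiff i j ('X_k * f) = 'X_k * divdiff i j f.
Proof.
move=> nij nki nkj; apply/esym/divdiff_uniq => //.
by rewrite -mulrA divdiffE msymM msym_tpermX tpermD 1?eq_sym // mulrBr.
Qed.

(** At an ascent the polynomial is itself a divided difference, hence symmetric in the two
    variables. *)
Lemma schubert_ascent_divdiff0 n (w : 'S_n) (i j : 'I_n) :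
  ascent w i j -> divdiff i j (schubert w) = 0.
Proof.
move=> asc; have nij : i != j.
  by case/andP: asc => /eqP e _; rewrite -val_eqE /= e; lia.
by rewrite (schubert_ascent asc) divdiff_sym // msym_divdiff.
Qed.

Lemma schubert_descent_divdiff n (w : 'S_n) (i j : 'I_n) :
  j = i.+1 :> nat -> (w j < w i)%N ->
  divdiff i j (schubert w) = schubert (swap_pos w i j).
Proof.
move=> ej lt_w; rewrite [RHS](@schubert_ascent n _ i j).
  by rewrite /swap_pos mulgA tperm2 mul1g.
by rewrite /ascent ej eqxx /= !permM tpermL tpermR.
Qed.

(** * The co-transition formula *)

Definition w0_prefix n (w : 'S_n) (k : nat) : Prop :=
  forall r : 'I_n, (r < k)%N -> w r = (n.-1 - r)%N :> nat.

(** Pigeonhole: the values above [n.-1 - k] are already taken by the first [k] positions. *)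
Lemma w0_prefix_le n (w : 'S_n) (k : nat) (m : 'I_n) :
  w0_prefix w k -> (k <= m)%N -> (w m <= n.-1 - k)%N.
Proof.
move=> wk km; rewrite leqNgt; apply/negP => lt.
have rn : (n.-1 - w m < n)%N by have := ltn_ord m; lia.
have := wk (Ordinal rn); have := ltn_ord (w m); move=> /= l1 h.
have {h} /val_inj/perm_inj/(congr1 val) /= : w (Ordinal rn) = w m :> nat.
  by rewrite h; lia.
by lia.
Qed.

(** The Bruhat covers: exchanging positions [k < j] raises the length by exactly one. *)
Definition cover_at n (w : 'S_n) (k j : 'I_n) : bool :=
  [&& (k < j)%N, (w k < w j)%N &
    [forall m : 'I_n, (k < m < j)%N ==> ~~ (w k < w m < w j)%N]].

Lemma cover_atP n (w : 'S_n) (k j : 'I_n) :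
  reflect [/\ (k < j)%N, (w k < w j)%N &
             forall m : 'I_n, (k < m)%N -> (m < j)%N ->
               (w k < w m)%N -> (w m < w j)%N -> False]
          (cover_at w k j).
Proof.
apply: (iffP and3P) => -[kj wkj H]; split=> //.
  move=> m km mj wkm wmj; have /implyP := forallP H m.
  by rewrite km mj wkm wmj => /(_ isT).
apply/forallP => m; apply/implyP => /andP[km mj]; apply/negP => /andP[].
exact: H.
Qed.

Lemma staircaseXE n : staircase_monomial n = 'X_[[multinom (n.-1 - i)%N | i < n]].
Proof.
rewrite /staircase_monomial mpolyXE_id; apply: eq_bigr => i _.
by rewrite mnmE.
Qed.

(** The extra factor makes the exponents of ['X_k] and ['X_k'] equal, so the monomial is symmetric
    in them. *)
Lemma divdiff_staircase n (k k' : 'I_n) : k' = k.+1 :> nat ->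
  divdiff k k' ('X_k' * staircase_monomial n) = 0.
Proof.
move=> ek; have nkk : k != k' by rewrite -val_eqE /= ek; lia.
apply: divdiff_sym => //; rewrite staircaseXE -mpolyXD msymX.
congr 'X_[_]; apply/mnmP => r; rewrite !mnmE tpermV.
have := ltn_ord k'.
by case: tpermP => [->|->|/eqP nk /eqP nk'];
  rewrite -?val_eqE /= ?eqxx //; lia.
Qed.

Lemma tperm_conjl n (i j k l : 'I_n) : k != i -> k != j ->
  (tperm i j * (tperm k l * tperm i j))%g = tperm k (tperm i j l).
Proof.
move=> nki nkj; rewrite -[in RHS](@tpermD _ i j k) 1?eq_sym //.
by rewrite -tpermJ conjgE tpermV.
Qed.

(** Applying the divided difference at [i] to the sum over the covers of [v] keeps only the terms
    [u] with a descent at [i]; relabelled by [tperm i i'], these are the covers of [w]. A term is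
    lost only for [j = i] with [w k < w i], where position [i] blocks the cover [(k, i')] of [w]. *)
Lemma cover_swap n (w : 'S_n) (k i i' j : 'I_n) : (k < i)%N -> ascent w i i' ->
  let v := swap_pos w i i' in let u := (tperm k j * v)%g in
  cover_at w k (tperm i i' j) = cover_at v k j && (u i' < u i)%N.
Proof.
move=> ki /andP[/eqP ei wi] v u.
have nki : k != i by rewrite -val_eqE /=; lia.
have nki' : k != i' by rewrite -val_eqE /=; lia.
have nii : i != i' by rewrite -val_eqE /=; lia.
have nii2 : i' != i by rewrite eq_sym.
have vE m : v m = w (tperm i i' m) by rewrite permM.
have vk : v k = w k by rewrite vE tpermD // eq_sym.
have vi : v i = w i' by rewrite vE tpermL.
have vi' : v i' = w i by rewrite vE tpermR.
have vD m : m != i -> m != i' -> v m = w m.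
  by move=> *; rewrite vE tpermD // eq_sym.
have winj m m' : w m = w m' :> nat -> m = m' by move/val_inj/perm_inj.
have uE m : u m = v (tperm k j m) by rewrite permM.
apply/cover_atP/andP => [[kj wkj H]|[/cover_atP[kj wkj H] lt_u]].
- split; last first.
    move: kj wkj H; rewrite !uE.
    case: (tpermP i i' j) => [->|->|/eqP ni /eqP ni'] kj wkj H.
    + rewrite tpermR tpermD // vk vi' ltnNge leq_eqVlt; apply/negP => /orP[].
        by move=> /eqP/winj /eqP; rewrite (negPf nki).
      by move=> l1; apply: (H i) => //; lia.
    + by rewrite tpermR tpermD // vk vi; lia.
    + by rewrite !tpermD ?vi ?vi'.
  apply/cover_atP; rewrite vk.
  move: kj wkj H; case: (tpermP i i' j) => [->|->|/eqP ni /eqP ni'] kj wkj H.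
  + rewrite vi; split=> // m km mi; rewrite vD -?val_eqE /=; [|lia..].
    by move=> l1 l2; apply: (H m); lia.
  + rewrite vi'; split=> //; first lia.
    move=> m km mi; have [->|ni] := eqVneq m i; first by rewrite vi; lia.
    rewrite vD //; last by rewrite -val_eqE /=; lia.
    by move=> l1 l2; apply: (H m) => //; rewrite -val_eqE /= in ni; lia.
  + rewrite vD //; split=> // m km mj; rewrite vE => l1 l2.
    apply: (H (tperm i i' m)) => //.
      by case: tpermP => [_|_|_ _]; lia.
    rewrite -val_eqE /= in ni; rewrite -val_eqE /= in ni'.
    by move: mj; case: tpermP => [->|->|_ _]; lia.
- rewrite vk in wkj H; move: lt_u; rewrite !uE.
  case: (tpermP i i' j) => [ej|ej|/eqP ni /eqP ni'].
  + subst j; rewrite tpermR tpermD // vk vi' => lt_u; rewrite vi in wkj H.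
    split=> //; first lia.
    move=> m km mi l1 l2; have [e|nm] := eqVneq m i; first by subst m; lia.
    have lm : (m < i)%N by rewrite -val_eqE /= in nm; lia.
    apply: (H m) => //; rewrite vD -?val_eqE //=; lia.
  + subst j; rewrite tpermR tpermD // vk vi => lt_u; rewrite vi' in wkj H.
    split=> // m km mi l1 l2.
    by apply: (H m); rewrite ?vD -?val_eqE //=; lia.
  + move=> _; rewrite vD // in wkj H; split=> // m km mj l1 l2.
    apply: (H (tperm i i' m)); rewrite ?vE ?tpermK //.
      by case: tpermP => [_|_|_ _]; lia.
    rewrite -val_eqE /= in ni; rewrite -val_eqE /= in ni'.
    by move: mj; case: tpermP => [->|->|_ _]; lia.
Qed.

(** Apply the divided difference at [i] to the formula for [swap_pos w i i']: it commutes with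
    ['X_k] because [k < i], and [cover_swap] identifies the surviving terms. *)
Lemma cotransition_step n (w : 'S_n) (k i i' : 'I_n) :
    (k < i)%N -> ascent w i i' ->
  'X_k * schubert (swap_pos w i i')
    = \sum_(j | cover_at (swap_pos w i i') k j)
         schubert (tperm k j * swap_pos w i i')%g ->
  'X_k * schubert w = \sum_(j | cover_at w k j) schubert (tperm k j * w)%g.
Proof.
move=> ki asc IH; have /andP[/eqP ei _] := asc.
have nki : k != i by rewrite -val_eqE /=; lia.
have nki' : k != i' by rewrite -val_eqE /=; lia.
have nii' : i != i' by rewrite -val_eqE /=; lia.
rewrite (schubert_ascent asc) -divdiffXl // IH big_mkcond divdiff_sum //.
rewrite [RHS]big_mkcond [RHS](reindex_inj (@perm_inj _ (tperm i i'))) /=.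
apply: eq_bigr => j _; rewrite (cover_swap j ki asc).
set v := swap_pos w i i'; set u := (tperm k j * v)%g.
case: (cover_at v k j); last exact: divdiff0.
have -> : (tperm k (tperm i i' j) * w = swap_pos u i i')%g.
  rewrite -(tperm_conjl _ nki nki') /u /v /swap_pos !mulgA.
  by congr (_ * _)%g; rewrite -!mulgA.
have [lt_u|] := ltnP (u i') (u i).
  exact: schubert_descent_divdiff.
rewrite leq_eqVlt => /orP[/eqP/val_inj/perm_inj e|lt_u].
  by rewrite e eqxx in nii'.
by rewrite schubert_ascent_divdiff0 // /ascent ei eqxx.
Qed.

(** A form of the twisted Leibniz rule; it replaces multiplication by ['X_k] with multiplication by
    ['X_k'] at the cost of one term [f]. *)
Lemma divdiff_Xl n (k k' : 'I_n) (f : {mpoly int[n]}) : k != k' ->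
  'X_k * divdiff k k' f = divdiff k k' ('X_k' * f) + f.
Proof.
move=> nkk; apply/eqP; rewrite -subr_eq; apply/eqP/divdiff_uniq => //.
rewrite mulrBl -mulrA divdiffE msymM msym_tpermX tpermR.
by ring.
Qed.

(** With no ascent beyond [k], the only usable swap involves [k] itself, and the formula for [v] is
    taken at [k'] instead. In [divdiff_Xl] the extra term is the summand of the cover [(k, k')]; the
    divided difference turns the covers of [v] at [k'] into the other summands. *)
Lemma cotransition_decreasing n (w : 'S_n) (k k' : 'I_n) :
    k' = k.+1 :> nat -> w0_prefix w k -> (w k < n.-1 - k)%N ->
    (forall i j : 'I_n, (k < i)%N -> (i < j)%N -> (w j < w i)%N) ->
    let v := swap_pos w k k' in
    (w0_prefix v k' -> (v k' < n.-1 - k')%N ->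
      'X_k' * schubert v
        = \sum_(j | cover_at v k' j) schubert (tperm k' j * v)%g) ->
  'X_k * schubert w = \sum_(j | cover_at w k j) schubert (tperm k j * w)%g.
Proof.
move=> ek pw wk dec v IH.
have nkk : k != k' by rewrite -val_eqE /= ek; lia.
have lk' := ltn_ord k'.
have winj m m' : w m = w m' :> nat -> m = m' by move/val_inj/perm_inj.
(* The largest value still available is not in the prefix, not at [k], and by monotonicity not after
   [k']. *)
have wk' : w k' = (n.-1 - k)%N :> nat.
  have qn : (n.-1 - k < n)%N by lia.
  pose q := (w^-1)%g (Ordinal qn).
  have wq : w q = (n.-1 - k)%N :> nat by rewrite permKV.
  have [lt_q|lt_q|/val_inj eq_q] := ltngtP q k'; last by rewrite -eq_q.
    have [lt_qk|le_kq] := ltnP q k; first by have := pw q lt_qk; lia.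
    have eqk : q = k by apply: val_inj => /=; lia.
    by rewrite eqk in wq; lia.
  have := dec k' q; have := @w0_prefix_le _ _ _ k' pw; lia.
have asc : ascent w k k' by rewrite /ascent ek eqxx /=; lia.
have vE m : v m = w (tperm k k' m) by rewrite permM.
have vk : v k = w k' by rewrite vE tpermL.
have vk' : v k' = w k by rewrite vE tpermR.
have vD (m : 'I_n) : (k' < m)%N -> v m = w m.
  by move=> lt; rewrite vE tpermD // -val_eqE /=; lia.
have pv : w0_prefix v k'.
  move=> r; rewrite ek ltnS leq_eqVlt => /orP[/eqP/val_inj->|lt_r].
    by rewrite vk.
  by rewrite vE tpermD -?val_eqE /=; [exact: pw|lia..].
have covk' : cover_at w k k'.
  by apply/cover_atP; split; [lia|lia|move=> m; lia].
rewrite (schubert_ascent asc) divdiff_Xl // -/v (bigD1 k' covk') /= addrC.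
congr (_ + _).
(* If [v k'] is already maximal, the induction hypothesis does not apply. Then [v] is [w0], the
   divided difference vanishes, and [k'] is the only cover of [w] at [k]. *)
have [lt_v|ge_v] := ltnP (v k') (n.-1 - k'); last first.
  have vk'E : v k' = (n.-1 - k')%N :> nat.
    by have := w0_prefix_le pv (leqnn k'); lia.
  have pv1 : w0_prefix v k'.+1.
    by move=> r; rewrite ltnS leq_eqVlt => /orP[/eqP/val_inj->|/pv].
  have -> : v = w0 n.
    apply: no_ascent_w0; apply/existsPn => -[i j] /=; apply/negP.
    case/andP=> /eqP ej; have [lt_ki|le_ik] := ltnP k' i.
      by rewrite !vD //; [have := dec i j; lia|lia].
    have -> := pv1 i le_ik.
    have pvi : w0_prefix v i.+1 by move=> r lt_r; apply: pv1; lia.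
    have := @w0_prefix_le _ _ _ j pvi; lia.
  rewrite schubert_w0 divdiff_staircase // big1 // => j /andP[/cover_atP[kj wkj _]].
  move/eqP => njk; case: njk; apply: winj.
  by move: vk'E; rewrite vk'; have := @w0_prefix_le _ _ _ j pw; lia.
rewrite (IH pv lt_v) big_mkcond divdiff_sum // [RHS]big_mkcond /=.
apply: eq_bigr => j _.
(* Since [v k' = w k] and the tail is decreasing, position [k'] lies outside every value interval in
   question. *)
have -> : cover_at w k j && (j != k') = cover_at v k' j.
  apply/andP/cover_atP => [[/cover_atP[kj wkj H] njk]|[kj vkj H]].
    have lt_j : (k' < j)%N by rewrite -val_eqE /= in njk; lia.
    rewrite vk' vD //; split=> // m km mj; rewrite vD //.
    by apply: H; lia.
  split; last by rewrite -val_eqE /=; lia.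
  rewrite vk' vD // in vkj H; apply/cover_atP; split=> //; first lia.
  move=> m km mj l1 l2; have [e|nm] := eqVneq m k'.
    by subst m; have := dec k' j; lia.
  have lt_m : (k' < m)%N by rewrite -val_eqE /= in nm; lia.
  by apply: (H m); rewrite ?vD.
case: ifP => [/cover_atP[kj vkj _]|_]; last exact: divdiff0.
have nkj : k != j by rewrite -val_eqE /=; lia.
have nkj' : k' != j by rewrite -val_eqE /=; lia.
rewrite schubert_descent_divdiff //; last first.
  have uE m : (tperm k' j * v)%g m = v (tperm k' j m) by rewrite permM.
  rewrite !uE tpermL tpermD 1?eq_sym // vk vD // wk'.
  by rewrite vk' vD // in vkj; have := dec k' j; lia.
congr schubert; rewrite (tpermC k j) -(tpermR k k') -tperm_conjl 1?eq_sym //.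
by rewrite tpermR /v /swap_pos (tpermC k' j) !mulgA.
Qed.

(** Induction on noninversions: an ascent beyond [k] is removed with [k] fixed; without one, the
    tail is decreasing and the induction moves on to [k.+1]. *)
Lemma cotransition n (w : 'S_n) (k : 'I_n) :
  w0_prefix w k -> (w k < n.-1 - k)%N ->
  'X_k * schubert w = \sum_(j | cover_at w k j) schubert (tperm k j * w)%g.
Proof.
have [N] := ubnP #|noninversions w|; elim: N w k => // N IHN w k ltN pw wk.
have IH v (k1 i i' : 'I_n) : v = swap_pos w i i' -> ascent w i i' -> w0_prefix v k1 ->
    (v k1 < n.-1 - k1)%N ->
    'X_k1 * schubert v = \sum_(j | cover_at v k1 j) schubert (tperm k1 j * v)%g.
  move=> -> asc; apply: IHN; apply: leq_trans (noninversions_swap_pos asc) _.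
  by rewrite -ltnS.
case: (pickP (fun p : 'I_n * 'I_n => (k < p.1)%N && ascent w p.1 p.2)).
  move=> [i i'] /= /andP[ki asc]; have /andP[/eqP ei _] := asc.
  apply: (cotransition_step ki asc); apply: (IH _ _ i i') => //.
    move=> r lt_r; rewrite permM tpermD -?val_eqE /=; [exact: pw|lia..].
  by rewrite permM tpermD // -val_eqE /=; lia.
move=> noasc.
have k1n : (k.+1 < n)%N by lia.
have dec (i j : 'I_n) : (k < i)%N -> (i < j)%N -> (w j < w i)%N.
  move=> ki lt_ij; have [d] := ubnP (j - i).
  elim: d j lt_ij => // d IHd j lt_ij ltd.
  have pj : (j.-1 < n)%N by have := ltn_ord j; lia.
  pose m := Ordinal pj.
  have lt_jm : (w j < w m)%N.
    have := noasc (m, j); rewrite /ascent /= prednK ?eqxx; last by lia.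
    have -> /= : (k < j.-1)%N by lia.
    rewrite ltnNge => /negbFE; rewrite leq_eqVlt => /orP[|//].
    by move=> /eqP/val_inj/perm_inj/(congr1 val) /=; lia.
  have [e|nm] := eqVneq m i; first by rewrite -e.
  rewrite -val_eqE /= in nm.
  by apply: ltn_trans lt_jm (IHd m _ _); rewrite /=; lia.
apply: (@cotransition_decreasing _ w k (Ordinal k1n)) => // pv vk.
apply: (IH _ _ k (Ordinal k1n)) => //; rewrite /ascent eqxx /=.
have := pv k (ltnSn k); rewrite permM tpermL => ->.
by lia.
Qed.

(** * Diagrams with raised boxes *)

Local Open Scope nat_scope.

Definition below n (A : {set 'I_n}) (z : nat) : nat := #|[set a in A | a < z]|.

(* A is obtained from D by moving elements towards 0. *)
Definition raised n (A D : {set 'I_n}) : Prop :=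
  #|A| = #|D| /\ forall z, below D z <= below A z.

Definition splice n (A B : {set 'I_n}) (z : nat) : {set 'I_n} :=
  [set a : 'I_n | if a < z then a \in B else a \in A].

Lemma sum_mem (T : finType) (A : {set T}) : \sum_x (x \in A) = #|A|.
Proof. by rewrite -sum1_card [RHS]big_mkcond; apply: eq_bigr => x _; case: ifP. Qed.

Lemma belowE n (A : {set 'I_n}) z : below A z = \sum_a ((a \in A) && (a < z)).
Proof. by rewrite /below -sum_mem; apply: eq_bigr => a _; rewrite inE. Qed.

Lemma below_all n (A : {set 'I_n}) z : n <= z -> below A z = #|A|.
Proof.
move=> le_n; rewrite belowE -sum_mem; apply: eq_bigr => a _.
by rewrite (leq_trans (ltn_ord a) le_n) andbT.
Qed.

Lemma below_max n (A : {set 'I_n}) z : below A z <= #|A|.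
Proof. by apply/subset_leq_card/subsetP => a; rewrite inE => /andP[]. Qed.

Lemma below_leq n (A : {set 'I_n}) y z : y <= z -> below A y <= below A z.
Proof.
move=> le_yz; apply/subset_leq_card/subsetP => a; rewrite !inE => /andP[-> /=].
by move/leq_trans; apply.
Qed.

Lemma belowS n (A : {set 'I_n}) (k : 'I_n) : below A k.+1 = below A k + (k \in A).
Proof.
rewrite !belowE (bigD1 k) //= [in RHS](bigD1 k) //= ltnSn ltnn andbT andbF add0n.
rewrite addnC; congr (_ + _); apply: eq_bigr => a nak.
by rewrite -val_eqE /= in nak; congr (nat_of_bool (_ && _)); lia.
Qed.

Lemma belowS_leq n (A : {set 'I_n}) z : below A z.+1 <= (below A z).+1.
Proof.
have [lt_zn|le_nz] := ltnP z n.
  have -> := @belowS _ A (Ordinal lt_zn); rewrite /= -addn1 leq_add2l.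
  exact: leq_b1.
by rewrite !below_all // ltnW.
Qed.

Lemma below_setT n z : z <= n -> below [set: 'I_n] z = z.
Proof.
move=> le_zn; rewrite belowE -[RHS]card_ord -sum1_card.
rewrite (big_ord_widen n (fun=> 1) le_zn) [RHS]big_mkcond.
by apply: eq_bigr => a _; rewrite inE; case: ifP.
Qed.

Lemma below_sub n (A B : {set 'I_n}) z :
  (forall a : 'I_n, a < z -> a \in A -> a \in B) -> below A z <= below B z.
Proof.
move=> sAB; apply/subset_leq_card/subsetP => a; rewrite !inE => /andP[Aa lt_a].
by rewrite lt_a sAB.
Qed.

Lemma below_id n (A : {set 'I_n}) z : below A z <= z.
Proof.
have [le_zn|lt_nz] := leqP z n.
  by rewrite -[leqRHS](below_setT le_zn); apply: below_sub => a; rewrite inE.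
rewrite (leq_trans (below_max A z)) // -(card_ord z).
by rewrite (leq_trans (max_card _)) // !card_ord ltnW.
Qed.

Lemma belowU1 n (A : {set 'I_n}) (k : 'I_n) z :
  k \notin A -> below (k |: A) z = below A z + (k < z).
Proof.
move=> kA; rewrite !belowE (bigD1 k) //= [in RHS](bigD1 k) //= !inE eqxx /=.
rewrite (negPf kA) add0n addnC; congr (_ + _); apply: eq_bigr => a nak.
by rewrite !inE (negPf nak).
Qed.

Lemma belowD1 n (A : {set 'I_n}) (k : 'I_n) z :
  k \in A -> below A z = below (A :\ k) z + (k < z).
Proof.
by move=> kA; rewrite -belowU1 ?setD1K // !inE eqxx.
Qed.

Lemma below_splice n (A B : {set 'I_n}) y z : below A z = below B z ->
  below (splice A B z) y = if y <= z then below B y else below A y.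
Proof.
move=> eq_z; case: leqP => [le_yz|lt_zy].
  rewrite !belowE; apply: eq_bigr => a _; rewrite inE.
  by case: ltnP => // le_za; rewrite !(ltnNge a) (leq_trans le_yz le_za) !andbF.
apply: (@addIn (below A z)); rewrite {2}eq_z !belowE -!big_split /=.
apply: eq_bigr => a _; rewrite inE; case: ltnP => [lt_az|]; last by rewrite !andbF.
by rewrite (ltn_trans lt_az lt_zy) !andbT addnC.
Qed.

Lemma card_splice n (A B : {set 'I_n}) z : below A z = below B z ->
  #|splice A B z| = #|A|.
Proof.
move=> eq_z; rewrite -!(@below_all _ _ (maxn n z.+1)) ?leq_maxl //.
by rewrite below_splice // ifN // -ltnNge leq_maxr.
Qed.

Lemma splice_raised n (A B D : {set 'I_n}) z : raised A D ->
  below A z = below B z -> (forall y, y <= z -> below D y <= below B y) ->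
  raised (splice A B z) D.
Proof.
move=> [cA bA] eq_z le_z; split; first by rewrite card_splice.
by move=> y; rewrite below_splice //; case: (leqP y z) => [/le_z|].
Qed.

(* The Rothe diagram of w with columns indexed by positions: x stands for the
   column w(x), so that the box (r, w(x)) is r \in diagram w x. *)
Definition diagram n (w : 'S_n) (x : 'I_n) : {set 'I_n} :=
  [set r : 'I_n | (r < x) && (w x < w r)].

Definition weight n (C : 'I_n -> {set 'I_n}) (r : 'I_n) : nat := \sum_x (r \in C x).

Definition raised_diagram n (w : 'S_n) (C : 'I_n -> {set 'I_n}) : Prop :=
  forall x, raised (C x) (diagram w x).

(* The initial segments of the columns x and j are swapped at the first height
   above k where both contain equally many boxes. *)
Lemma exchange_columns n (w : 'S_n) (C : 'I_n -> {set 'I_n}) (k x j : 'I_n) (z : nat) :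
    raised_diagram w C -> w0_prefix w k -> (k < x) -> (w k < w x) -> x != j ->
    k \in C x -> k \notin C j ->
    k < z -> below (C x) z <= below (C j) z ->
    (forall r, r <= z -> below (diagram w x) r <= below (C j) r) ->
  exists C' : 'I_n -> {set 'I_n},
    [/\ raised_diagram w C', weight C' =1 weight C & k \notin C' x].
Proof.
move=> rC pw kx wkx nxj kCx kCj kz le_z Dz.
have ltw (r : 'I_n) : r < k -> w x < w r.
  by move=> rk; rewrite (pw r rk); have := w0_prefix_le pw (ltnW kx); lia.
(* All rows before [k] belong to [diagram w x], and raising boxes cannot vacate them. *)
have fullk r : r <= k -> r <= below (C x) r.
  move=> rk; apply: leq_trans (proj2 (rC x) r).
  rewrite -{1}(@below_setT n r); last by have := ltn_ord k; lia.
  by apply: below_sub => a lt_a _; rewrite inE ltw ?andbT //; lia.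
have exz : exists z, (k < z) && (below (C x) z <= below (C j) z).
  by exists z; rewrite kz.
case: (ex_minnP exz) => z0 /andP[kz0 le_z0] min_z0.
have le_zz : z0 <= z by apply: min_z0; rewrite kz.
have gt_z0 r : r < z0 -> below (C j) r <= below (C x) r.
  move=> lt_r; have [lt_kr|le_rk] := ltnP k r.
    rewrite leqNgt; apply/negP => /ltnW le_r.
    by have := min_z0 r; rewrite lt_kr le_r => /(_ isT); lia.
  by apply: leq_trans (fullk r le_rk); apply: below_id.
(* A count grows by at most one per row, so it cannot jump past the other at the first crossing; row
   [k] itself favours column [x]. *)
have eq_z0 : below (C x) z0 = below (C j) z0.
  apply/eqP; rewrite eqn_leq le_z0 /=.
  case: z0 kz0 le_z0 min_z0 gt_z0 {le_zz} => // y; rewrite ltnS leq_eqVlt.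
  case/orP=> [/eqP<-|lt_ky] le_z0 min_z0 gt_z0.
    rewrite !belowS kCx (negPf kCj) addn0.
    by rewrite (leq_trans (gt_z0 k (ltnSn k))) ?leq_addr.
  apply: leq_trans (belowS_leq _ _) _; apply: leq_trans (below_leq _ (leqnSn y)).
  rewrite ltnNge; apply/negP => le_y.
  by have := min_z0 y; rewrite lt_ky le_y => /(_ isT); rewrite ltnn.
pose C' y := if y == x then splice (C x) (C j) z0
             else if y == j then splice (C j) (C x) z0 else C y.
exists C'; split.
- move=> y; rewrite /C'; have [->|nyx] := eqVneq y x.
    apply: splice_raised => // r le_r; apply: Dz; exact: leq_trans le_zz.
  have [->|nyj] := eqVneq y j => //.
  apply: splice_raised => // r le_r; apply: leq_trans (proj2 (rC j) r) _.
  move: le_r; rewrite leq_eqVlt => /orP[/eqP->|/gt_z0//].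
  by rewrite eq_z0.
- move=> r; rewrite /weight /C' (bigD1 x) //= [in RHS](bigD1 x) //=.
  rewrite eq_sym in nxj; rewrite (bigD1 j) //= [in RHS](bigD1 j) //= !eqxx (negPf nxj).
  rewrite !addnA; congr (_ + _).
    by rewrite !inE; case: ifP => // _; rewrite addnC.
  by apply: eq_bigr => y /andP[/negPf-> /negPf->].
- by rewrite /C' eqxx inE kz0.
Qed.

(** A row of column [x] missing from column [j] would be a position between [k] and [x] whose value
    lies between [w k] and [w j], against the choice of [x] as the first such position. *)
Lemma diagram_sub_last n (w : 'S_n) (k x j : 'I_n) :
    w0_prefix w k -> k < x -> x < j -> w k < w x -> w x < w j ->
    (forall y : 'I_n, k < y -> w k < w y -> w y < w j -> y < j -> x <= y) ->
  forall r, r \in diagram w x -> r \in diagram w j.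
Proof.
move=> pw kx xj wkx wxj minx r; rewrite !inE => /andP[rx wxr].
have rj := ltn_trans rx xj; rewrite rj /=.
have [lt_rk|lt_kr|/val_inj eq_r] := ltngtP r k.
- by rewrite (pw r lt_rk); have := @w0_prefix_le _ _ _ j pw; lia.
- rewrite ltnNge leq_eqVlt; apply/negP => /orP[/eqP/val_inj/perm_inj e|lt_wr].
    by rewrite e ltnn in rj.
  by have := minx r lt_kr (ltn_trans wkx wxr) lt_wr rj; lia.
- by rewrite eq_r in wxr; lia.
Qed.

(** Exchanging [k] and [j] adds one box, in row [k] of column [j]; in a column of intermediate value
    the box in row [j] jumps up to row [k]. *)
Lemma diagram_cover n (w : 'S_n) (k j x : 'I_n) :
    w0_prefix w k -> cover_at w k j ->
    (forall y : 'I_n, k < y -> w k < w y -> w y < w j -> j < y) ->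
  diagram (tperm k j * w)%g x =
    if x == j then k |: diagram w j
    else if (k < x) && (w k < w x < w j) then k |: (diagram w x :\ j)
    else diagram w x.
Proof.
move=> pw /cover_atP[kj wkj _] H.
have nkj : k != j by rewrite -val_eqE /=; lia.
have winj m m' : w m = w m' :> nat -> m = m' by move/val_inj/perm_inj.
have wlt (r : 'I_n) : r < k -> w j < w r.
  by move=> rk; rewrite (pw r rk); have := w0_prefix_le pw (ltnW kj); lia.
apply/setP => r; rewrite inE !permM.
have [->|nxj] := eqVneq x j.
  rewrite tpermR !inE; case: (tpermP k j r) => [->|->|/eqP nk /eqP nj].
  - by rewrite eqxx kj wkj.
  - by rewrite ltnn eq_sym (negPf nkj).
  - rewrite (negPf nk) /=; case: ltnP => //= rj.
    apply/idP/idP => [wkr|]; last by move=> /(ltn_trans wkj).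
    have [lt_rk|lt_kr|/val_inj eq_r] := ltngtP r k; first exact: wlt.
      rewrite ltnNge leq_eqVlt; apply/negP => /orP[/eqP/winj/eqP|lt_wr].
        by rewrite (negPf nj).
      by have := H r lt_kr wkr lt_wr; lia.
    by rewrite eq_r eqxx in nk.
have [->|nxk] := eqVneq x k.
  rewrite ltnn /= tpermL inE; case: ltnP => //= rk.
  by rewrite tpermD -?val_eqE /=; have := wlt r rk; lia.
rewrite [X in w X]tpermD 1?eq_sym //.
have nwxk : w x != w k :> nat by apply: contraNneq nxk => /winj->.
have nwxj : w x != w j :> nat by apply: contraNneq nxj => /winj->.
case: ifP => [/and3P[kx wkx wxj]|].
  have jx := H x kx wkx wxj.
  rewrite !inE; case: (tpermP k j r) => [->|->|/eqP nk /eqP nj].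
  - by rewrite eqxx kx wxj.
  - by rewrite eqxx eq_sym (negPf nkj) /= jx /=; lia.
  - by rewrite (negPf nk) (negPf nj).
move=> Hx; rewrite !inE; have [kx|] := ltnP k x.
  rewrite kx /= in Hx; case: (tpermP k j r) => [->|->|//]; first lia.
  by case: (j < x) => //=; lia.
move=> le_xk; case: ltnP => //= rx.
by rewrite tpermD // -val_eqE /=; lia.
Qed.

(** In an intermediate column the diagram gains one box in the counts from [k] to [j], so [C] needs
    one to spare there. The strict inequality with column [j] supplies it, because up to row [j]
    that column of the diagram is contained in column [j]. *)
Lemma raised_diagram_cover n (w : 'S_n) (C : 'I_n -> {set 'I_n}) (k j : 'I_n) :
    raised_diagram w C -> w0_prefix w k -> k \notin C j -> cover_at w k j ->
    (forall y : 'I_n, k < y -> w k < w y -> w y < w j -> j < y) ->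
    (forall x : 'I_n, k < x -> w k < w x -> w x < w j -> k \in C x) ->
    (forall (x : 'I_n) z, k < x -> w k < w x -> w x < w j -> k < z -> z <= j ->
       below (C j) z < below (C x) z) ->
  raised_diagram (tperm k j * w)%g (fun y => if y == j then k |: C j else C y).
Proof.
move=> rC pw kCj cov H kC gtC y; rewrite (diagram_cover _ pw cov H).
have /cover_atP[kj wkj _] := cov.
have kD (x : 'I_n) : w k < w x -> k \notin diagram w x by rewrite inE; lia.
have [ey|nyj] := eqVneq y j.
  have [cD bD] := rC j.
  split; first by rewrite !cardsU1 kCj kD // cD.
  by move=> z; rewrite !belowU1 ?kD // leq_add2r.
case: ifP => // /and3P[ky wky wyj]; have [cD bD] := rC y.
have jy := H y ky wky wyj.
have jD : j \in diagram w y by rewrite inE jy wyj.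
have kDj : k \notin diagram w y :\ j by rewrite in_setD1 (negPf (kD y wky)) andbF.
have DE z : z <= j -> below (diagram w y) z <= below (diagram w j) z.
  move=> le_zj; apply: below_sub => r lt_r; rewrite !inE => /andP[_ wyr].
  rewrite (leq_trans lt_r le_zj) /=.
  have [lt_rk|lt_kr|/val_inj eq_r] := ltngtP r k.
  - by rewrite (pw r lt_rk); have := w0_prefix_le pw (ltnW kj); lia.
  - rewrite ltnNge leq_eqVlt; apply/negP => /orP[/eqP/val_inj/perm_inj e|lt_wr].
      by subst r; lia.
    by have := H r lt_kr (ltn_trans wky wyr) lt_wr; lia.
  - by rewrite eq_r in wyr; lia.
split; first by rewrite cardsU1 kDj cD (cardsD1 j (diagram w y)) jD.
move=> z; rewrite belowU1 //; have := bD z; have := belowD1 z jD.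
have [le_zk|lt_kz] := leqP z k; first by lia.
have [le_zj|lt_jz] := leqP z j; last by lia.
have := gtC y z ky wky wyj lt_kz le_zj; have := DE z le_zj.
by have := proj2 (rC j) z; lia.
Qed.

(* Among the columns x with k < x and w(k) < w(x), take the one, j, of least value
   that does not contain row k; exchanging it with a column of smaller value
   decreases w(j), and once no exchange is possible w t_kj covers w. *)
Lemma raise_step n (w : 'S_n) (C : 'I_n -> {set 'I_n}) (k : 'I_n) :
    w0_prefix w k -> w k < n.-1 - k -> raised_diagram w C ->
  exists j (C' : 'I_n -> {set 'I_n}),
    [/\ cover_at w k j, raised_diagram (tperm k j * w)%g C' &
        forall r, weight C' r = weight C r + (r == k)].
Proof.
move=> pw wk rC.
(* The column of value [n.-1 - k] qualifies: its boxes are exactly the rows before [k], so they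
   cannot rise and row [k] stays empty. *)
have [j [kj wkj kCj]] : exists j : 'I_n, [/\ k < j, w k < w j & k \notin C j].
  have qn : n.-1 - k < n by have := ltn_ord k; lia.
  pose j := (w^-1)%g (Ordinal qn).
  have wj : w j = n.-1 - k :> nat by rewrite permKV.
  have kj : k < j.
    rewrite ltnNge leq_eqVlt; apply/negP => /orP[/eqP/val_inj e|lt_jk].
      by rewrite e in wj; lia.
    by have := pw j lt_jk; have := ltn_ord k; lia.
  exists j; rewrite wj; split=> //.
  have [cD bD] := rC j.
  have DE : diagram w j = [set r : 'I_n | r < k].
    apply/setP => r; rewrite !inE wj; have [lt_rk|le_kr] := ltnP r k.
      by rewrite (pw r lt_rk); have := ltn_ord k; lia.
    by have := w0_prefix_le pw le_kr; lia.
  have cDk : below (diagram w j) k = #|diagram w j|.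
    by congr #|pred_of_set _|; apply/setP => r; rewrite DE !inE andbb.
  apply/negP => kC; have := bD k; rewrite cDk -cD.
  have := below_max (C j) k.+1; rewrite belowS kC; lia.
have [N] := ubnP (w j); elim: N C rC j kj wkj kCj => // N IHN C rC j kj wkj kCj ltN.
have [/existsP[x /and4P[kx wkx wxj kCx]]|/existsPn none] :=
    boolP [exists x : 'I_n, [&& k < x, w k < w x, w x < w j & k \notin C x]].
  by apply: (IHN C rC x) => //; lia.
have kC (x : 'I_n) : k < x -> w k < w x -> w x < w j -> k \in C x.
  by move=> kx wkx wxj; have := none x; rewrite kx wkx wxj /= negbK.
have exch (x : 'I_n) (z : nat) : k < x -> w k < w x -> w x < w j -> k < z ->
    below (C x) z <= below (C j) z ->
    (forall r, r <= z -> below (diagram w x) r <= below (C j) r) ->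
    exists j' (C' : 'I_n -> {set 'I_n}),
      [/\ cover_at w k j', raised_diagram (tperm k j' * w)%g C' &
          forall r, weight C' r = weight C r + (r == k)].
  move=> kx wkx wxj kz le_z Dz.
  have nxj : x != j by apply/eqP => e; rewrite e ltnn in wxj.
  have [C' [rC' wC' kC']] :=
    exchange_columns rC pw kx wkx nxj (kC x kx wkx wxj) kCj kz le_z Dz.
  have [|j' [C'' [cov rC'' wC'']]] := IHN C' rC' x kx wkx kC'; first by lia.
  by exists j', C''; split=> // r; rewrite wC'' wC'.
pose P (x : 'I_n) := [&& k < x, w k < w x, w x < w j & x < j].
(* For the leftmost intermediate position [x] before [j], column [x] of the diagram is contained in
   column [j], so the bound [z = n] permits an exchange. *)
have [x0 Px0|none'] := pickP P.
  have [x /and4P[kx wkx wxj xj] minx] := arg_minnP (fun y : 'I_n => y : nat) Px0.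
  have sub : forall r, r \in diagram w x -> r \in diagram w j.
    apply: (diagram_sub_last pw) => // y ky wky wyj yj.
    by apply: minx; rewrite /P ky wky wyj.
  apply: (exch x n) => //.
    by rewrite !below_all // (proj1 (rC x)) (proj1 (rC j)); apply/subset_leq_card/subsetP.
  move=> r _; apply: leq_trans (proj2 (rC j) r); apply: below_sub => a _; exact: sub.
have H (y : 'I_n) : k < y -> w k < w y -> w y < w j -> j < y.
  move=> ky wky wyj; have := none' y; rewrite /P ky wky wyj /= => /negbT.
  by rewrite -leqNgt leq_eqVlt => /orP[/eqP/val_inj e|//]; rewrite e ltnn in wyj.
have cov : cover_at w k j.
  by apply/cover_atP; split=> // m km mj wkm wmj; have := H m km wkm wmj; lia.
(* Now no intermediate value sits between positions [k] and [j], so rows before [j] of column [x]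
   lie in column [j], and a crossing at [z <= j] also permits an exchange. Without a crossing, the
   strict inequality needed by [raised_diagram_cover] holds. *)
have [/existsP[x /existsP[z /and5P[kx wkx wxj kz le_z]]]|/existsPn nocross] :=
    boolP [exists x : 'I_n, exists z : 'I_n.+1,
      [&& k < x, w k < w x, w x < w j, k < z & (z <= j) &&
          (below (C x) z <= below (C j) z)]].
  have /andP[zj bz] := le_z.
  apply: (exch x z) => // r le_rz; apply: leq_trans (proj2 (rC j) r).
  apply: below_sub => a lt_a; rewrite !inE => /andP[_ wxa].
  have lt_aj : a < j by lia.
  rewrite lt_aj /=; have [lt_ak|lt_ka|/val_inj eq_a] := ltngtP a k.
  - by rewrite (pw a lt_ak); have := w0_prefix_le pw (ltnW kj); lia.
  - rewrite ltnNge leq_eqVlt; apply/negP => /orP[/eqP/val_inj/perm_inj e|lt_wa].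
      by subst a; lia.
    by have := H a lt_ka (ltn_trans wkx wxa) lt_wa; lia.
  - by rewrite eq_a in wxa; lia.
exists j, (fun y => if y == j then k |: C j else C y); split=> //.
  apply: (raised_diagram_cover rC pw kCj cov H kC) => x z kx wkx wxj kz zj.
  have zn : z < n.+1 by have := ltn_ord j; lia.
  have /existsPn/(_ (Ordinal zn)) := nocross x.
  by rewrite kx wkx wxj /= kz zj /= -ltnNge.
move=> r; rewrite /weight (bigD1 j) //= [in RHS](bigD1 j) //= eqxx !inE.
rewrite (eq_bigr (fun x => nat_of_bool (r \in C x))) => [|x /negPf->//].
have [->|_] := eqVneq r k; first by rewrite (negPf kCj) add0n addnC.
by rewrite addn0.
Qed.

(** * Supports of Schubert polynomials *)

Lemma rearrangement2 a b c d : a < b -> c < d -> a * d + b * c < a * c + b * d.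
Proof.
move=> ab cd; rewrite -(subnKC (ltnW ab)) -(subnKC (ltnW cd)).
have := muln_gt0 (b - a) (d - c); rewrite !subn_gt0 ab cd.
move: (b - a) (d - c) => x y; nia.
Qed.

(** The rearrangement inequality; it makes this sum a termination measure for covers at arbitrary
    distance. *)
Lemma swap_measure n (w : 'S_n) (k j : 'I_n) : k < j -> w k < w j ->
  \sum_(r < n) r * (tperm k j * w)%g r < \sum_(r < n) r * w r.
Proof.
move=> kj wkj; have njk : j != k by rewrite -val_eqE /=; lia.
rewrite (bigD1 k) //= (bigD1 j) //= [ltnRHS](bigD1 k) //= [X in _ < _ + X](bigD1 j) //=.
rewrite !permM tpermL tpermR !addnA.
rewrite (eq_bigr (fun r : 'I_n => r * w r)) => [|r /andP[rk rj]]; last first.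
  by rewrite permM tpermD // eq_sym.
rewrite ltn_add2r; exact: rearrangement2.
Qed.

Lemma w0_prefix_all n (w : 'S_n) : w0_prefix w n -> w = w0 n.
Proof.
move=> pw; apply/permP => r; rewrite permE; apply/val_inj.
by rewrite /= pw //; lia.
Qed.

Lemma w0_prefix_max n (w : 'S_n) :
  w = w0 n \/ exists k : 'I_n, w0_prefix w k /\ w k < n.-1 - k.
Proof.
pose P (k : 'I_n) := w k != n.-1 - k :> nat.
have [k0 Pk0|none] := pickP P.
  right; have [k nk mink] := arg_minnP (fun y : 'I_n => y : nat) Pk0.
  have pw : w0_prefix w k.
    move=> r lt_rk; apply/eqP/negPn/negP => /mink; lia.
  exists k; split=> //; have := w0_prefix_le pw (leqnn k).
  by rewrite leq_eqVlt (negPf nk).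
by left; apply: w0_prefix_all => r _; have /negbFE/eqP := none r.
Qed.

(** Every column of the diagram of [w0] is an initial segment, so nothing can be raised and [C] is
    that diagram. *)
Lemma weight_w0 n (C : 'I_n -> {set 'I_n}) : raised_diagram (w0 n) C ->
  forall r, weight C r = n.-1 - r.
Proof.
move=> rC r; rewrite /weight.
have DE x : diagram (w0 n) x = [set a : 'I_n | a < x].
  by apply/setP => a; rewrite !inE !permE /=; have := ltn_ord x; lia.
rewrite (eq_bigr (fun x : 'I_n => nat_of_bool (r < x))) => [|x _]; last first.
  suff -> : C x = [set a : 'I_n | a < x] by rewrite inE.
  have [cD bD] := rC x; rewrite DE in cD bD.
  have sC : [set a in C x | a < x] = C x.
    apply/eqP; rewrite eqEcard cD; apply/andP; split.
      by apply/subsetP => a; rewrite inE => /andP[].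
    rewrite (leq_trans _ (bD x)) // /below.
    by apply/subset_leq_card/subsetP => a; rewrite !inE => ->.
  apply/eqP; rewrite eqEcard cD leqnn andbT.
  by apply/subsetP => a; rewrite -sC !inE => /andP[].
have eq_r : \sum_(x < n) (x < r.+1) = r.+1.
  rewrite -[RHS](below_setT (ltn_ord r)) belowE.
  by apply: eq_bigr => x _; rewrite in_setT.
have eq_n : \sum_(x < n) (r < x) + \sum_(x < n) (x < r.+1) = n.
  rewrite -big_split /= -[RHS]card_ord -sum1_card; apply: eq_bigr => x _; lia.
by rewrite eq_r in eq_n; have := congr1 (subn^~ r.+1) eq_n; rewrite /= addnK => ->; lia.
Qed.

Lemma mcoeff_cotransition n (w : 'S_n) (k : 'I_n) (a : 'X_{1..n}) :
    w0_prefix w k -> w k < n.-1 - k ->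
  (((schubert w)@_a)
    = \sum_(j | cover_at w k j) (schubert (tperm k j * w)%g)@_(U_(k) + a))%R.
Proof.
by move=> pw wk; rewrite -raddf_sum /= -cotransition // mulrC mcoeffMX.
Qed.

Lemma mcoeff_schubert_ge0 n (w : 'S_n) (a : 'X_{1..n}) : (0 <= (schubert w)@_a)%R.
Proof.
have [N] := ubnP (\sum_(r < n) r * w r); elim: N w a => // N IHN w a ltN.
have [->|[k [pw wk]]] := w0_prefix_max w.
  by rewrite schubert_w0 staircaseXE mcoeffX ler0n.
rewrite (mcoeff_cotransition _ pw wk); apply: sumr_ge0 => j /cover_atP[kj wkj _].
by apply: IHN; exact: leq_trans (swap_measure kj wkj) ltN.
Qed.

(** In the co-transition sum, [raise_step] provides one summand that is positive by induction, and
    nonnegativity of the others excludes cancellation. *)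
Lemma mcoeff_raised_diagram n (w : 'S_n) (C : 'I_n -> {set 'I_n}) :
  raised_diagram w C -> (0 < (schubert w)@_[multinom weight C i | i < n])%R.
Proof.
have [N] := ubnP (\sum_(r < n) r * w r); elim: N w C => // N IHN w C ltN rC.
have [e|[k [pw wk]]] := w0_prefix_max w.
  rewrite e schubert_w0 staircaseXE mcoeffX; rewrite e in rC.
  suff -> : [multinom (n.-1 - i)%N | i < n] = [multinom weight C i | i < n].
    by rewrite eqxx.
  by apply/mnmP => i; rewrite !mnmE weight_w0.
have [j [C' [cov rC' wC']]] := raise_step pw wk rC.
have /cover_atP[kj wkj _] := cov.
rewrite (mcoeff_cotransition _ pw wk) (bigD1 j) //=.
apply: ltr_wpDr; first by apply: sumr_ge0 => x _; apply: mcoeff_schubert_ge0.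
suff -> : (U_(k) + [multinom weight C i | i < n])%MM = [multinom weight C' i | i < n].
  by apply: IHN => //; exact: leq_trans (swap_measure kj wkj) ltN.
by apply/mnmP => i; rewrite !mnmE wC' addnC eq_sym.
Qed.

(** * Vectors reached by moving boxes *)

Definition move_boxes n (C : 'I_n -> {set 'I_n}) (X : {set 'I_n}) (p i : 'I_n)
    (x : 'I_n) : {set 'I_n} :=
  if x \in X then p |: (C x :\ i) else C x.

Lemma raised_move n (A D : {set 'I_n}) (p i : 'I_n) :
  raised A D -> p < i -> i \in A -> p \notin A -> raised (p |: (A :\ i)) D.
Proof.
move=> [cA bA] pi iA pA.
have pAi : p \notin A :\ i by rewrite in_setD1 (negPf pA) andbF.
split; first by rewrite cardsU1 pAi -cA (cardsD1 i A) iA.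
by move=> z; rewrite belowU1 //; have := bA z; have := belowD1 z iA; lia.
Qed.

Lemma raised_move_boxes n (w : 'S_n) C (X : {set 'I_n}) (p i : 'I_n) :
    raised_diagram w C -> p < i ->
    (forall x, x \in X -> (i \in C x) && (p \notin C x)) ->
  raised_diagram w (move_boxes C X p i).
Proof.
move=> rC pi H x; rewrite /move_boxes; case: ifP => // /H/andP[iC pC].
exact: raised_move.
Qed.

Lemma weight_move_boxes n (C : 'I_n -> {set 'I_n}) (X : {set 'I_n}) (p i : 'I_n) :
    p < i -> (forall x, x \in X -> (i \in C x) && (p \notin C x)) ->
  forall r, ((weight (move_boxes C X p i) r)%:Z
    = (weight C r)%:Z + (if p == r then #|X|%:Z else 0)
      + (if i == r then - #|X|%:Z else 0))%R.
Proof.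
move=> pi H r.
have npi : p != i by rewrite -val_eqE /=; lia.
(* The balance is first taken over the naturals, with the boxes lost by row [i] added back on the
   left. *)
have E : weight (move_boxes C X p i) r + (i == r) * #|X|
       = weight C r + (p == r) * #|X|.
  rewrite -sum_mem !big_distrr -!big_split /=; apply: eq_bigr => x _.
  rewrite /move_boxes; case: ifP => [/H/andP[iC pC]|_]; last by rewrite !muln0.
  rewrite !muln1 !inE !(eq_sym _ r).
  have [->|nrp] := eqVneq r p; first by rewrite (negPf npi) (negPf pC).
  by have [->|nri] := eqVneq r i; rewrite ?iC ?addn0.
have [ep|np] := eqVneq p r.
  have ni : (i == r) = false by rewrite -ep eq_sym (negPf npi).
  by move: E; rewrite ep ni !eqxx; lia.
by move: E; rewrite (negPf np); case: (i == r); lia.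
Qed.

(** The Lehmer code, as the row lengths of the Rothe diagram. *)
Definition code n (w : 'S_n) : 'I_n -> nat := weight (diagram w).

(* The vector with value z at index r for (r, z) in L. *)
Definition sparse n (L : seq ('I_n * int)) (r : 'I_n) : int :=
  (\sum_(q <- L) if q.1 == r then q.2 else 0)%R.

(** A normal form that makes the list recoverable from the vector [sparse L]. *)
Definition sparse_wf n (L : seq ('I_n * int)) : bool :=
  sorted (fun q q' : 'I_n * int => q.1 < q'.1) L
    && all (fun q : 'I_n * int => q.2 != 0%R) L.

Lemma sparse_wf_cons n (q : 'I_n * int) L : sparse_wf (q :: L) ->
  [/\ sparse_wf L, q.2 != 0%R & forall r : 'I_n, r <= q.1 -> sparse L r = 0%R].
Proof.
case/andP=> /= pL /andP[nq aL]; split=> // [|r le_r].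
  by rewrite /sparse_wf aL andbT (path_sorted pL).
have tr : transitive (fun q q' : 'I_n * int => q.1 < q'.1).
  by move=> x y z; apply: ltn_trans.
have /allP a1 := order_path_min tr pL.
rewrite /sparse big_seq big1 // => x /a1 lt; case: eqP => // e.
by rewrite e ltnNge le_r in lt.
Qed.

(** The head of a normal form sits at the first nonzero entry of its vector, so equal vectors have
    equal heads, which can be cancelled. *)
Lemma sparse_inj n (L L' : seq ('I_n * int)) :
  sparse_wf L -> sparse_wf L' -> sparse L =1 sparse L' -> L = L'.
Proof.
have sE q M r : @sparse n (q :: M) r = ((if q.1 == r then q.2 else 0) + sparse M r)%R.
  by rewrite /sparse big_cons.
have s0 r : @sparse n [::] r = 0%R by rewrite /sparse big_nil.
have first_lt q M q' M' : sparse_wf (q :: M) -> sparse_wf (q' :: M') ->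
    @sparse n (q :: M) =1 sparse (q' :: M') -> q'.1 <= q.1.
  case/sparse_wf_cons=> _ nq zM /sparse_wf_cons[_ nq' zM'] e.
  rewrite leqNgt; apply/negP => lt; have := e q.1; rewrite !sE eqxx.
  rewrite zM // zM' ?(ltnW lt) // ifN ?addr0 => [/eqP|]; first by rewrite (negPf nq).
  by rewrite -val_eqE /=; lia.
elim: L L' => [|q L IHL] [|q' L'] // wf wf' e.
- have [_ nq' z] := sparse_wf_cons wf'; have := e q'.1.
  by rewrite sE eqxx s0 z // addr0 => /esym/eqP; rewrite (negPf nq').
- have [_ nq z] := sparse_wf_cons wf; have := e q.1.
  by rewrite sE eqxx s0 z // addr0 => /eqP; rewrite (negPf nq).
have eq1 : q.1 = q'.1.
  apply/val_inj/eqP; rewrite eqn_leq /= (first_lt q' L' q L) //.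
  by rewrite (first_lt q L q' L').
have [wfL nq z] := sparse_wf_cons wf; have [wfL' nq' z'] := sparse_wf_cons wf'.
have eq2 : q.2 = q'.2.
  by have := e q.1; rewrite !sE -eq1 !eqxx z // z' ?eq1 // !addr0.
have -> : q = q' by rewrite [q]surjective_pairing eq1 eq2 -surjective_pairing.
congr (_ :: _); apply: IHL => // r; have := e r.
by rewrite !sE eq1 eq2 => /addrI.
Qed.

(** Exponent vectors are recorded as displacements from the code, so that distinct exponents can be
    told apart by short lists. *)
Definition supported n (w : 'S_n) (L : seq ('I_n * int)) : Prop :=
  exists2 C, raised_diagram w C &
    forall r, ((weight C r)%:Z = (code w r)%:Z + sparse L r)%R.

Lemma size_supported n (w : 'S_n) (Ls : seq (seq ('I_n * int))) :
  uniq Ls -> (forall L, L \in Ls -> sparse_wf L /\ supported w L) ->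
  size Ls <= theta w.
Proof.
move=> uLs H.
(* The absolute value loses nothing on [Ls]: there the entries are weights, hence nonnegative. *)
pose f (L : seq ('I_n * int)) := [multinom absz ((code w r)%:Z + sparse L r)%R | r < n].
have fE L (r : 'I_n) : L \in Ls -> ((f L r)%:Z = (code w r)%:Z + sparse L r)%R.
  by case/H=> _ [C _ wC]; rewrite mnmE -wC.
rewrite -(size_map f); apply: uniq_leq_size.
  rewrite map_inj_in_uniq // => L L' LL LL' e.
  apply: sparse_inj; [exact: (H _ LL).1|exact: (H _ LL').1|] => r.
  by apply: (addrI (code w r)%:Z%R); rewrite -!fE // e.
move=> _ /mapP[L LL ->]; have [_ [C rC wC]] := H L LL.
have -> : f L = [multinom weight C r | r < n].
  by apply/mnmP => r; rewrite !mnmE -wC.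
by rewrite mcoeff_msupp gt_eqF // mcoeff_raised_diagram.
Qed.

(* The columns having a box in row i and none in row p. *)
Definition row_between n (w : 'S_n) (p i : 'I_n) : {set 'I_n} :=
  [set x : 'I_n | [&& i < x, w p < w x & w x < w i]].

Lemma row_between_diagram n (w : 'S_n) (p i x : 'I_n) :
  x \in row_between w p i -> (i \in diagram w x) && (p \notin diagram w x).
Proof. by rewrite !inE; lia. Qed.

Lemma raised_diagram_refl n (w : 'S_n) : raised_diagram w (diagram w).
Proof. by move=> x; split. Qed.

Lemma supported_nil n (w : 'S_n) : supported w [::].
Proof.
exists (diagram w); first exact: raised_diagram_refl.
by move=> r; rewrite /sparse big_nil addr0.
Qed.

Lemma supported2 n (w : 'S_n) (p i : 'I_n) (X : {set 'I_n}) :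
  p < i -> X \subset row_between w p i ->
  supported w [:: (p, #|X|%:Z); (i, - #|X|%:Z)]%R.
Proof.
move=> pi /subsetP sX.
have HX x : x \in X -> (i \in diagram w x) && (p \notin diagram w x).
  by move/sX/row_between_diagram.
exists (move_boxes (diagram w) X p i).
  exact: raised_move_boxes (raised_diagram_refl w) pi HX.
move=> r; rewrite (weight_move_boxes pi HX) /sparse !big_cons big_nil /= /code.
by rewrite addr0 addrA.
Qed.

Lemma supported3 n (w : 'S_n) (p i i' : 'I_n) (X Y : {set 'I_n}) :
  p < i -> p < i' -> X \subset row_between w p i -> Y \subset row_between w p i' ->
  [disjoint X & Y] ->
  supported w [:: (p, (#|X| + #|Y|)%:Z); (i, - #|X|%:Z); (i', - #|Y|%:Z)]%R.
Proof.
move=> pi pi' /subsetP sX /subsetP sY dXY.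
have HX x : x \in X -> (i \in diagram w x) && (p \notin diagram w x).
  by move/sX/row_between_diagram.
(* By disjointness the first move has not touched the columns of [Y]. *)
have HY x : x \in Y -> let C := move_boxes (diagram w) X p i in
    (i' \in C x) && (p \notin C x).
  by move=> xY; rewrite /= /move_boxes (disjointFl dXY xY); apply/row_between_diagram/sY.
exists (move_boxes (move_boxes (diagram w) X p i) Y p i').
  apply: raised_move_boxes => //.
  exact: raised_move_boxes (raised_diagram_refl w) pi HX.
move=> r; rewrite (weight_move_boxes pi' HY) (weight_move_boxes pi HX).
rewrite /sparse !big_cons big_nil /= /code PoszD.
by case: (p == r); ring.
Qed.

Lemma supported4 n (w : 'S_n) (p i k l : 'I_n) (X Y : {set 'I_n}) :
  p < i -> i < k -> k < l -> X \subset row_between w p i ->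
  Y \subset row_between w k l ->
  supported w [:: (p, #|X|%:Z); (i, - #|X|%:Z); (k, #|Y|%:Z); (l, - #|Y|%:Z)]%R.
Proof.
move=> pi ik kl /subsetP sX /subsetP sY.
have HX x : x \in X -> (i \in diagram w x) && (p \notin diagram w x).
  by move/sX/row_between_diagram.
(* [X] and [Y] may share columns, but the rows [p], [i], [k], [l] are distinct, so the first move
   leaves rows [k] and [l] alone. *)
have HY x : x \in Y -> let C := move_boxes (diagram w) X p i in
    (l \in C x) && (k \notin C x).
  move=> /sY/row_between_diagram; rewrite /= /move_boxes; case: ifP => // _.
  case/andP=> lD kD; rewrite !in_setU1 !in_setD1 lD (negPf kD) -!val_eqE /=; lia.
exists (move_boxes (move_boxes (diagram w) X p i) Y k l).
  apply: raised_move_boxes => //.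
  exact: raised_move_boxes (raised_diagram_refl w) pi HX.
move=> r; rewrite (weight_move_boxes kl HY) (weight_move_boxes pi HX).
by rewrite /sparse !big_cons big_nil /= /code; ring.
Qed.

(** For [j] in [A] the cardinality is the rank of [j], counted from 1; thus an element of [A]
    encodes a positive number of boxes to move. *)
Definition initial n (A : {set 'I_n}) (j : 'I_n) : {set 'I_n} :=
  [set x in A | x <= j].

Lemma initial_sub n (A : {set 'I_n}) (j : 'I_n) : initial A j \subset A.
Proof. by apply/subsetP => x; rewrite inE => /andP[]. Qed.

Lemma initial_neq0 n (A : {set 'I_n}) (j : 'I_n) :
  j \in A -> (#|initial A j|%:Z != 0)%R.
Proof.
move=> jA; have : 0 < #|initial A j| by apply/card_gt0P; exists j; rewrite inE jA /=.
by lia.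
Qed.

Lemma card_initial_inj n (A : {set 'I_n}) : {in A &, injective (fun j => #|initial A j|)}.
Proof.
suff H (j j' : 'I_n) : j' \in A -> j < j' -> #|initial A j| < #|initial A j'|.
  move=> j j' jA j'A e; apply: val_inj => /=.
  have [lt|lt|//] := ltngtP j j'; first by have := H j j' j'A lt; rewrite e ltnn.
  by have := H j' j jA lt; rewrite e ltnn.
move=> j'A lt; apply: proper_card; apply/properP; split.
  by apply/subsetP => x; rewrite !inE => /andP[-> /leq_trans]; apply; apply: ltnW.
by exists j'; rewrite !inE j'A ?leqnn // -ltnNge.
Qed.

(** These are the positions of the 132 patterns. *)
Definition triples n (w : 'S_n) : {set 'I_n * 'I_n * 'I_n} :=
  [set t : 'I_n * 'I_n * 'I_n | let: (p, i, j) := t in (p < i) && (j \in row_between w p i)].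

(* The ranks of j and j' in these disjoint sets of columns are the numbers of boxes
   moved to row p from rows i and i'; disjointness makes the choices independent. *)
Definition quintuples n (w : 'S_n) : {set 'I_n * 'I_n * 'I_n * 'I_n * 'I_n} :=
  [set t : 'I_n * 'I_n * 'I_n * 'I_n * 'I_n | let: (p, i, i', j, j') := t in
    [&& p < i, i < i', j \in row_between w p i :\: row_between w p i' &
        j' \in row_between w p i :&: row_between w p i']].

(** Pairs of 132 patterns [(p, i, j)] and [(k, l, j')] with [i < k]; the column [j] may lie anywhere
    after [i]. *)
Definition sextuples n (w : 'S_n) : {set 'I_n * 'I_n * 'I_n * 'I_n * 'I_n * 'I_n} :=
  [set t : 'I_n * 'I_n * 'I_n * 'I_n * 'I_n * 'I_n | let: (p, i, k, l, j, j') := t in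
    [&& p < i, i < k, k < l, j \in row_between w p i & j' \in row_between w k l]].

Definition triple_vector n (w : 'S_n) (t : 'I_n * 'I_n * 'I_n) : seq ('I_n * int) :=
  let: (p, i, j) := t in
  let s := #|initial (row_between w p i) j|%:Z%R in
  [:: (p, s); (i, - s)]%R.

Definition quintuple_vector n (w : 'S_n) (t : 'I_n * 'I_n * 'I_n * 'I_n * 'I_n) :
    seq ('I_n * int) :=
  let: (p, i, i', j, j') := t in
  let s := #|initial (row_between w p i :\: row_between w p i') j| in
  let s' := #|initial (row_between w p i :&: row_between w p i') j'| in
  [:: (p, (s + s')%:Z); (i, - s%:Z); (i', - s'%:Z)]%R.

Definition sextuple_vector n (w : 'S_n) (t : 'I_n * 'I_n * 'I_n * 'I_n * 'I_n * 'I_n) :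
    seq ('I_n * int) :=
  let: (p, i, k, l, j, j') := t in
  let s := #|initial (row_between w p i) j|%:Z%R in
  let s' := #|initial (row_between w k l) j'|%:Z%R in
  [:: (p, s); (i, - s); (k, s'); (l, - s')]%R.

Lemma mem_triples n (w : 'S_n) p i j :
  ((p, i, j) \in triples w) = (p < i) && (j \in row_between w p i).
Proof. by rewrite in_set. Qed.

Lemma mem_quintuples n (w : 'S_n) p i i' j j' :
  ((p, i, i', j, j') \in quintuples w) =
    [&& p < i, i < i', j \in row_between w p i :\: row_between w p i' &
        j' \in row_between w p i :&: row_between w p i'].
Proof. by rewrite in_set. Qed.

Lemma mem_sextuples n (w : 'S_n) p i k l j j' :
  ((p, i, k, l, j, j') \in sextuples w) =
    [&& p < i, i < k, k < l, j \in row_between w p i & j' \in row_between w k l].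
Proof. by rewrite in_set. Qed.

Lemma triple_vector_inj n (w : 'S_n) : {in triples w &, injective (triple_vector w)}.
Proof.
move=> [[p i] j] [[p1 i1] j1].
rewrite !mem_triples => /andP[_ Hj] /andP[_ Hj1] [ep es ei _]; subst p1 i1.
by rewrite (card_initial_inj Hj Hj1 es).
Qed.

Lemma quintuple_vector_inj n (w : 'S_n) :
  {in quintuples w &, injective (quintuple_vector w)}.
Proof.
move=> [[[[p i] i'] j] j'] [[[[p1 i1] i1'] j1] j1'].
rewrite !mem_quintuples => /and4P[_ _ Hj Hj'] /and4P[_ _ Hj1 Hj1'].
case=> ep _ ei /oppr_inj[es] ei' /oppr_inj[es']; subst p1 i1 i1'.
by rewrite (card_initial_inj Hj Hj1 es) (card_initial_inj Hj' Hj1' es').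
Qed.

Lemma sextuple_vector_inj n (w : 'S_n) :
  {in sextuples w &, injective (sextuple_vector w)}.
Proof.
move=> [[[[[p i] k] l] j] j'] [[[[[p1 i1] k1] l1] j1] j1'].
rewrite !mem_sextuples => /and5P[_ _ _ Hj Hj'] /and5P[_ _ _ Hj1 Hj1'].
case=> ep es ei _ ek es' el _; subst p1 i1 k1 l1.
by rewrite (card_initial_inj Hj Hj1 es) (card_initial_inj Hj' Hj1' es').
Qed.

Lemma supported_triple n (w : 'S_n) t : t \in triples w ->
  sparse_wf (triple_vector w t) /\ supported w (triple_vector w t).
Proof.
case: t => [[p i] j]; rewrite mem_triples => /andP[pi Hj]; split.
  by rewrite /sparse_wf /= pi oppr_eq0 !initial_neq0.
exact: supported2 pi (initial_sub _ _).
Qed.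

Lemma supported_quintuple n (w : 'S_n) t : t \in quintuples w ->
  sparse_wf (quintuple_vector w t) /\ supported w (quintuple_vector w t).
Proof.
case: t => [[[[p i] i'] j] j']; rewrite mem_quintuples => /and4P[pi ii' Hj Hj']; split.
  have n1 := initial_neq0 Hj; have n2 := initial_neq0 Hj'.
  rewrite /sparse_wf /= pi ii' !oppr_eq0 n1 n2 !andbT /=.
  by rewrite eqz_nat addn_eq0 negb_and -eqz_nat n1.
apply: supported3 => //; first exact: ltn_trans ii'.
- exact: subset_trans (initial_sub _ _) (subsetDl _ _).
- exact: subset_trans (initial_sub _ _) (subsetIr _ _).
- apply: disjointWl (initial_sub _ _) _; apply: disjointWr (initial_sub _ _) _.
  by rewrite -setI_eq0; apply/eqP/setP => x; rewrite in_set0 2!in_setI in_setD;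
    case: (x \in row_between w p i'); rewrite ?andbF.
Qed.

Lemma supported_sextuple n (w : 'S_n) t : t \in sextuples w ->
  sparse_wf (sextuple_vector w t) /\ supported w (sextuple_vector w t).
Proof.
case: t => [[[[[p i] k] l] j] j']; rewrite mem_sextuples => /and5P[pi ik kl Hj Hj']; split.
  by rewrite /sparse_wf /= pi ik kl !oppr_eq0 !initial_neq0.
by apply: supported4 => //; apply: initial_sub.
Qed.

(** The families cannot overlap, since their normal forms have lengths 0, 2, 3 and 4. The empty
    list, which stands for the code itself, gives the summand 1. *)
Lemma theta_tuples n (w : 'S_n) :
  1 + #|triples w| + #|quintuples w| + #|sextuples w| <= theta w.
Proof.
pose Ls := [::] :: map (triple_vector w) (enum (triples w))
  ++ map (quintuple_vector w) (enum (quintuples w))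
  ++ map (sextuple_vector w) (enum (sextuples w)).
have s3 L : L \in map (triple_vector w) (enum (triples w)) -> size L = 2.
  by case/mapP=> -[[? ?] ?] _ ->.
have s5 L : L \in map (quintuple_vector w) (enum (quintuples w)) -> size L = 3.
  by case/mapP=> -[[[[? ?] ?] ?] ?] _ ->.
have s6 L : L \in map (sextuple_vector w) (enum (sextuples w)) -> size L = 4.
  by case/mapP=> -[[[[[? ?] ?] ?] ?] ?] _ ->.
have -> : 1 + #|triples w| + #|quintuples w| + #|sextuples w| = size Ls.
  by rewrite /= !size_cat !size_map -!cardE add1n !addSn addnA.
apply: size_supported.
  rewrite /= !mem_cat !cat_uniq !map_inj_in_uniq ?enum_uniq /=; first last.
  - by move=> x y; rewrite !mem_enum; apply: triple_vector_inj.
  - by move=> x y; rewrite !mem_enum; apply: quintuple_vector_inj.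
  - by move=> x y; rewrite !mem_enum; apply: sextuple_vector_inj.
  apply/and3P; split.
  - by apply/negP => /orP[/s3|/orP[/s5|/s6]].
  - apply/hasPn => L; rewrite mem_cat => LL; apply/negP => /s3.
    by case/orP: LL => [/s5->|/s6->].
  - rewrite andbT; apply/hasPn => L /s6 e; apply/negP => /s5; by rewrite e.
move=> L; rewrite inE !mem_cat => /or4P[/eqP->|/mapP[t]|/mapP[t]|/mapP[t]].
- by split=> //; apply: supported_nil.
- by rewrite mem_enum => Ht ->; apply: supported_triple.
- by rewrite mem_enum => Ht ->; apply: supported_quintuple.
- by rewrite mem_enum => Ht ->; apply: supported_sextuple.
Qed.

(** * Counting patterns *)

Definition increasing m n (c : {ffun 'I_m -> 'I_n}) : bool :=
  [forall a : 'I_m, forall b : 'I_m, (a < b) ==> (c a < c b)].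

Lemma increasingP m n (c : {ffun 'I_m -> 'I_n}) :
  reflect (forall a b : 'I_m, a < b -> c a < c b) (increasing c).
Proof.
apply: (iffP forallP) => H a; last by apply/forallP => b; apply/implyP/H.
by move=> b; have /forallP/(_ b)/implyP := H a.
Qed.

Definition occurrence m n (u : seq nat) (w : 'S_n) (c : {ffun 'I_m -> 'I_n}) : bool :=
  increasing c && [forall a : 'I_m, forall b : 'I_m,
    (w (c a) < w (c b)) == (nth 0 u a < nth 0 u b)].

Lemma pattern_countE m n (u : seq nat) (w : 'S_n) : size u = m ->
  pattern_count u w = \sum_(c : {ffun 'I_m -> 'I_n}) occurrence u w c.
Proof.
by move<-; rewrite /pattern_count -sum_mem; apply: eq_bigr => c _; rewrite inE.
Qed.

Local Notation "''o_' i" := (@Ordinal 5 i isT) (at level 8, i at level 2, format "''o_' i").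

Definition lts n (w : 'S_n) (c : {ffun 'I_5 -> 'I_n}) (a b : 'I_5) : bool := w (c a) < w (c b).

(** For distinct values, the ten comparisons at positions [a < b] determine the relative order. *)
Definition upper_pairs (T : Type) (f : 'I_5 -> 'I_5 -> T) : seq T :=
  [:: f 'o_0 'o_1; f 'o_0 'o_2; f 'o_0 'o_3; f 'o_0 'o_4; f 'o_1 'o_2;
      f 'o_1 'o_3; f 'o_1 'o_4; f 'o_2 'o_3; f 'o_2 'o_4; f 'o_3 'o_4].

Lemma occurrence_upper n (u : seq nat) (w : 'S_n) (c : {ffun 'I_5 -> 'I_n}) :
  occurrence u w c ->
  upper_pairs (lts w c) == upper_pairs (fun a b : 'I_5 => nth 0 u a < nth 0 u b).
Proof.
case/andP=> _ /forallP H; have E a b : lts w c a b = (nth 0 u a < nth 0 u b).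
  by have /forallP/(_ b)/eqP := H a.
by rewrite /upper_pairs !E.
Qed.

(** A check of all truth values. The six conjunctions are the quintuple shapes [None], [Some true],
    [Some false] and the sextuple shapes with shared position 2, 3, 4; the coefficient of each
    pattern is the number of shapes that it realizes. *)
Lemma pattern_weights (b01 b02 b03 b04 b12 b13 b14 b23 b24 b34 : bool) :
  let bs := [:: b01; b02; b03; b04; b12; b13; b14; b23; b24; b34] in
  let occ u := bs == upper_pairs (fun a b : 'I_5 => nth 0 u a < nth 0 u b) in
  occ [:: 1; 3; 2; 5; 4] + 3 * occ [:: 1; 4; 2; 5; 3] + occ [:: 1; 4; 3; 5; 2]
    + 4 * occ [:: 1; 5; 2; 4; 3] + occ [:: 1; 5; 3; 2; 4]
    + 2 * occ [:: 1; 5; 3; 4; 2] + occ [:: 1; 5; 4; 3; 2]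
    + occ [:: 2; 4; 1; 5; 3] + 2 * occ [:: 2; 5; 1; 4; 3]
    + occ [:: 3; 5; 1; 4; 2]
  <= ([&& b02, ~~ b12, b04, ~~ b14 & ~~ b34] + [&& b03, ~~ b13, b23, b04, ~~ b14 & ~~ b24]
       + [&& b04, ~~ b14, b24, b03, ~~ b13 & ~~ b23])
     + ([&& b02, ~~ b12, b24 & ~~ b34] + [&& b03, ~~ b13, b24 & ~~ b34]
       + [&& b04, ~~ b14, b24 & ~~ b34]).
Proof.
by case: b01; case: b02; case: b03; case: b04; case: b12;
  case: b13; case: b14; case: b23; case: b24; case: b34.
Qed.

Lemma ltn_perm_neg n (w : 'S_n) (x y : 'I_n) : x != y -> ~~ (w x < w y) = (w y < w x).
Proof.
move=> nxy; rewrite -leqNgt leq_eqVlt; case: eqP => // /val_inj/perm_inj e.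
by rewrite e eqxx in nxy.
Qed.

Lemma ffun5_eq (T : Type) (c c' : {ffun 'I_5 -> T}) :
  c 'o_0 = c' 'o_0 -> c 'o_1 = c' 'o_1 -> c 'o_2 = c' 'o_2 -> c 'o_3 = c' 'o_3 ->
  c 'o_4 = c' 'o_4 -> c = c'.
Proof.
move=> e0 e1 e2 e3 e4; apply/ffunP => -[[|[|[|[|[|//]]]]] lt];
  by rewrite (bool_irrelevance lt isT).
Qed.

Lemma increasing5P n (c : {ffun 'I_5 -> 'I_n}) : increasing c ->
  [/\ c 'o_0 < c 'o_1, c 'o_1 < c 'o_2, c 'o_2 < c 'o_3 & c 'o_3 < c 'o_4].
Proof. by move/increasingP => H; split; apply: H. Qed.

Lemma sum_card_pairs (T1 T2 T3 : finType) (A : {set T3}) (P : T1 -> T2 -> bool)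
    (f : T1 * T2 -> T3) :
  {in [pred t | P t.1 t.2] &, injective f} ->
  (forall x y, P x y -> f (x, y) \in A) ->
  \sum_x \sum_y P x y <= #|A|.
Proof.
move=> injf fA; rewrite pair_big /=.
have -> : \sum_(t : T1 * T2) P t.1 t.2 = #|[set t : T1 * T2 | P t.1 t.2]|.
  by rewrite -sum_mem; apply: eq_bigr => t _; rewrite inE.
rewrite -(card_in_imset (f := f)); last first.
  by move=> x y; rewrite !inE => Px Py; apply: injf.
by apply/subset_leq_card/subsetP => _ /imsetP[[x y] + ->]; rewrite inE; apply: fA.
Qed.

(* For e = 'o_2, 'o_3, 'o_4 the 132 patterns (c 0, c 1, c e) and (c 2, c 3, c 4)
   share the position c e; no other e is possible. *)
Definition sextuple_of n (t : {ffun 'I_5 -> 'I_n} * 'I_5) :=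
  let: (c, e) := t in (c 'o_0, c 'o_1, c 'o_2, c 'o_3, c e, c 'o_4).

Definition sextuple_pattern n (w : 'S_n) (c : {ffun 'I_5 -> 'I_n}) (e : 'I_5) : bool :=
  [&& increasing c, c e \in row_between w (c 'o_0) (c 'o_1) &
      c 'o_4 \in row_between w (c 'o_2) (c 'o_3)].

Lemma sextuple_patterns n (w : 'S_n) :
  \sum_c \sum_e sextuple_pattern w c e <= #|sextuples w|.
Proof.
apply: (sum_card_pairs (f := @sextuple_of n)).
  move=> [c e] [c' e']; rewrite !inE /= => /andP[inc _] _ [e0 e1 e2 e3 ee e4].
  have ec : c = c' by apply: ffun5_eq.
  subst c'; congr (_, _); apply: val_inj => /=.
  have /increasingP H := inc.
  by have [/H|/H|//] := ltngtP e e'; rewrite ee ltnn.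
move=> c e /and3P[/increasing5P[c01 c12 c23 c34] He H4].
by rewrite mem_sextuples c01 c12 c23 He H4.
Qed.

(** The three possible orders when the five positions are distinct: [j < i' < j'] for [None],
    [i' < j < j'] for [Some true], [i' < j' < j] for [Some false]. *)
Definition quintuple_of n (t : {ffun 'I_5 -> 'I_n} * option bool) :=
  let: (c, e) := t in
  match e with
  | None => (c 'o_0, c 'o_1, c 'o_3, c 'o_2, c 'o_4)
  | Some true => (c 'o_0, c 'o_1, c 'o_2, c 'o_3, c 'o_4)
  | Some false => (c 'o_0, c 'o_1, c 'o_2, c 'o_4, c 'o_3)
  end.

Definition quintuple_pattern n (w : 'S_n) (c : {ffun 'I_5 -> 'I_n}) (e : option bool) : bool :=
  increasing c && (quintuple_of (c, e) \in quintuples w).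

Lemma quintuple_patterns n (w : 'S_n) :
  pattern_count [:: 1; 4; 3; 2] w + \sum_c \sum_e quintuple_pattern w c e
    <= #|quintuples w|.
Proof.
(* Quintuples with [i' = j] have only four positions and receive the 1432 patterns; the remaining
   ones receive the patterns of length five. *)
pose D := [set t : 'I_n * 'I_n * 'I_n * 'I_n * 'I_n | t.1.1.2 == t.1.2].
rewrite -(cardsID D); apply: leq_add.
  rewrite (@pattern_countE 4) //.
  pose f (c : {ffun 'I_4 -> 'I_n}) :=
    (c (@Ordinal 4 0 isT), c (@Ordinal 4 1 isT), c (@Ordinal 4 2 isT),
     c (@Ordinal 4 2 isT), c (@Ordinal 4 3 isT)).
  have -> : \sum_(c : {ffun 'I_4 -> 'I_n}) occurrence [:: 1; 4; 3; 2] w c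
          = #|[set c : {ffun 'I_4 -> 'I_n} | occurrence [:: 1; 4; 3; 2] w c]|.
    by rewrite -sum_mem; apply: eq_bigr => c _; rewrite inE.
  rewrite -(card_imset (f := f)); last first.
    move=> c c' [e0 e1 e2 _ e3]; apply/ffunP => -[[|[|[|[|//]]]] lt];
      by rewrite (bool_irrelevance lt isT).
  apply/subset_leq_card/subsetP => _ /imsetP[c + ->]; rewrite inE.
  case/andP=> /increasingP inc /forallP H.
  have lt a b : (w (c a) < w (c b)) = (nth 0 [:: 1; 4; 3; 2] a < nth 0 [:: 1; 4; 3; 2] b).
    by have /forallP/(_ b)/eqP := H a.
  by rewrite in_setI mem_quintuples in_setD in_setI !inE !lt /= ltnn eqxx !inc.
apply: (sum_card_pairs (f := @quintuple_of n)).
  move=> [c e] [c' e']; rewrite !inE /= => /andP[inc _] /andP[inc' _].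
  have [c01 c12 c23 c34] := increasing5P inc.
  have [c01' c12' c23' c34'] := increasing5P inc'.
  (* Equal shapes force [c = c']; different shapes order [i'], [j], [j'] differently, which
     contradicts monotonicity. *)
  case: e => [[]|]; case: e' => [[]|] [e0 e1 e2 e3 e4];
    try (by rewrite (@ffun5_eq _ c c')); exfalso;
    move: c12 c23 c34 c12' c23' c34'; rewrite ?e0 ?e1 ?e2 ?e3 ?e4; lia.
move=> c e /andP[/increasing5P[c01 c12 c23 c34] H]; rewrite in_setD H andbT.
by rewrite inE; case: e {H} => [[]|] /=; rewrite -val_eqE /=; lia.
Qed.

Lemma triple_patterns n (w : 'S_n) : pattern_count [:: 1; 3; 2] w <= #|triples w|.
Proof.
rewrite (@pattern_countE 3) //.
pose f (c : {ffun 'I_3 -> 'I_n}) :=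
  (c (@Ordinal 3 0 isT), c (@Ordinal 3 1 isT), c (@Ordinal 3 2 isT)).
have -> : \sum_(c : {ffun 'I_3 -> 'I_n}) occurrence [:: 1; 3; 2] w c
        = #|[set c : {ffun 'I_3 -> 'I_n} | occurrence [:: 1; 3; 2] w c]|.
  by rewrite -sum_mem; apply: eq_bigr => c _; rewrite inE.
rewrite -(card_imset (f := f)); last first.
  move=> c c' [e0 e1 e2]; apply/ffunP => -[[|[|[|//]]] lt];
    by rewrite (bool_irrelevance lt isT).
apply/subset_leq_card/subsetP => _ /imsetP[c + ->]; rewrite inE.
case/andP=> /increasingP inc /forallP H.
have lt a b : (w (c a) < w (c b)) = (nth 0 [:: 1; 3; 2] a < nth 0 [:: 1; 3; 2] b).
  by have /forallP/(_ b)/eqP := H a.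
by rewrite mem_triples !inE !lt /= !inc.
Qed.

Lemma leq_nat_of_bool (P Q : bool) : (P -> Q) -> P <= Q.
Proof. by case: P Q => [] [] // /(_ isT). Qed.

Lemma pattern_weights_pointwise n (w : 'S_n) (c : {ffun 'I_5 -> 'I_n}) :
  let occ u := occurrence u w c in
  occ [:: 1; 3; 2; 5; 4] + 3 * occ [:: 1; 4; 2; 5; 3] + occ [:: 1; 4; 3; 5; 2]
    + 4 * occ [:: 1; 5; 2; 4; 3] + occ [:: 1; 5; 3; 2; 4]
    + 2 * occ [:: 1; 5; 3; 4; 2] + occ [:: 1; 5; 4; 3; 2]
    + occ [:: 2; 4; 1; 5; 3] + 2 * occ [:: 2; 5; 1; 4; 3]
    + occ [:: 3; 5; 1; 4; 2]
  <= \sum_e quintuple_pattern w c e + \sum_e sextuple_pattern w c e.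
Proof.
case inc: (increasing c); last first.
  by rewrite /= /occurrence inc.
have occ_upper u : occurrence u w c <=
    (upper_pairs (lts w c) == upper_pairs (fun a b : 'I_5 => nth 0 u a < nth 0 u b)).
  by apply: leq_nat_of_bool; apply: occurrence_upper.
have := pattern_weights (lts w c 'o_0 'o_1) (lts w c 'o_0 'o_2) (lts w c 'o_0 'o_3)
  (lts w c 'o_0 'o_4) (lts w c 'o_1 'o_2) (lts w c 'o_1 'o_3) (lts w c 'o_1 'o_4)
  (lts w c 'o_2 'o_3) (lts w c 'o_2 'o_4) (lts w c 'o_3 'o_4).
rewrite -/(upper_pairs (lts w c)) => key; apply: leq_trans (leq_trans key _) => {key}.
  by rewrite /= !leq_add ?leq_mul ?occ_upper.
have [c01 c12 c23 c34] := increasing5P inc.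
(* Distinct positions carry distinct values, so each negated comparison becomes the strict reverse
   one required by [row_between]. *)
have ltP (a b : 'I_5) : a < b -> ~~ lts w c a b = (w (c b) < w (c a)).
  move=> /(increasingP _ inc) lt; apply: ltn_perm_neg; rewrite -val_eqE /=; lia.
rewrite !ltP //; apply: leq_add.
  rewrite (bigD1 None) //= (bigD1 (Some true)) //= (bigD1 (Some false)) //= !addnA.
  apply: leq_trans (leq_addr _ _).
  apply: leq_add; [apply: leq_add|]; apply: leq_nat_of_bool;
    rewrite /lts /quintuple_pattern inc /= mem_quintuples in_setD in_setI !inE; lia.
rewrite (bigD1 'o_2) //= (bigD1 'o_3) //= (bigD1 'o_4) //= !addnA.
apply: leq_trans (leq_addr _ _).
apply: leq_add; [apply: leq_add|]; apply: leq_nat_of_bool;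
  rewrite /lts /sextuple_pattern inc /= !inE; lia.
Qed.

Theorem theorem1p1 (n : nat) (hn : (1 <= n)%N) (w : 'S_n) :
  (1 + pattern_count [:: 1; 3; 2] w
     + pattern_count [:: 1; 4; 3; 2] w
     + pattern_count [:: 1; 3; 2; 5; 4] w
     + 3 * pattern_count [:: 1; 4; 2; 5; 3] w
     + pattern_count [:: 1; 4; 3; 5; 2] w
     + 4 * pattern_count [:: 1; 5; 2; 4; 3] w
     + pattern_count [:: 1; 5; 3; 2; 4] w
     + 2 * pattern_count [:: 1; 5; 3; 4; 2] w
     + pattern_count [:: 1; 5; 4; 3; 2] w
     + pattern_count [:: 2; 4; 1; 5; 3] w
     + 2 * pattern_count [:: 2; 5; 1; 4; 3] w
     + pattern_count [:: 3; 5; 1; 4; 2] w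
   <= theta w)%N.
Proof.
apply: leq_trans (theta_tuples w).
(* Summing the pointwise inequality over all [c] turns the occurrence indicators into pattern counts
   and the right side into the sums bounded by quintuples and sextuples. *)
have five := @leq_sum _ (index_enum {ffun 'I_5 -> 'I_n}) xpredT _ _
  (fun c _ => pattern_weights_pointwise w c).
rewrite !big_split /= !big1_eq -!pattern_countE // in five.
have le4 := leq_add (quintuple_patterns w) (sextuple_patterns w).
rewrite -addnA in le4; have := leq_trans (leq_add (leqnn _) five) le4.
have := triple_patterns w; lia.
Qed.
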